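(* There exists a planar almost hypohamiltonian graph of order $n$ whose exceptional vertex is cubic (has degree $3$) for (i) every $n = 36 + 4k$ with $k \ge 0$ an integer, and (ii) every $n \ge 73$.
   Context: All graphs are finite, undirected, connected, without loops or multiple edges. A graph is hamiltonian if it has a cycle through all its vertices. A non-hamiltonian graph $G$ is almost hypohamiltonian if there exists a vertex $w$ (the exceptional vertex) such that $G - w$ is non-hamiltonian and $G - v$ is hamiltonian for every vertex $v \neq w$. *)

(* Defs.v *)
From Stdlib Require Import Reals.
From mathcomp Require Import all_boot.

Set Implicit Arguments.
Unset Strict Implicit.
Unset Printing Implicit Defensive.

Section Graphs.
Variable T : finType.

Definition simple_graph (e : rel T) : Prop :=
  (forall x y, e x y = e y x) /\ (forall x, ~~ e x x).

Definition connected_graph (e : rel T) : Prop :=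
  forall x y, connect e x y.

Definition degree (e : rel T) (v : T) : nat := #|[set u | e v u]|.

Definition hamiltonian_on (e : rel T) (S : {set T}) : Prop :=
  exists s : seq T, [/\ uniq s, s =i S, 2 < size s & cycle e s].

Definition hamiltonian (e : rel T) : Prop := hamiltonian_on e [set: T].

Definition hamiltonian_minus (e : rel T) (v : T) : Prop :=
  hamiltonian_on e [set~ v].

Definition almost_hypohamiltonian_with (e : rel T) (w : T) : Prop :=
  [/\ ~ hamiltonian e, ~ hamiltonian_minus e w &
      forall v, v != w -> hamiltonian_minus e v].

Local Open Scope R_scope.

Definition planar (e : rel T) : Prop :=
  exists (px py : T -> R) (ax ay : T -> T -> R -> R),
    [/\ (forall u v, px u = px v -> py u = py v -> u = v),
        (forall u v, e u v ->
           [/\ (forall t, continuity_pt (ax u v) t) /\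
                 (forall t, continuity_pt (ay u v) t),
               ax u v 0 = px u /\ ay u v 0 = py u,
               ax u v 1 = px v /\ ay u v 1 = py v,
               (forall s t, 0 <= s <= 1 -> 0 <= t <= 1 ->
                  ax u v s = ax u v t -> ay u v s = ay u v t -> s = t) &
               (forall t w, 0 < t < 1 ->
                  ~ (ax u v t = px w /\ ay u v t = py w))]) &
        (forall u v u' v', e u v -> e u' v' ->
           ~ (u = u' /\ v = v') -> ~ (u = v' /\ v = u') ->
           forall s t, 0 <= s <= 1 -> 0 <= t <= 1 ->
             ax u v s = ax u' v' t -> ay u v s = ay u' v' t ->
             (s = 0 \/ s = 1) /\ (t = 0 \/ t = 1))].

End Graphs.

(* Main.v *)
(** The starting point is a planar graph J in which every face is a pentagon except one
    quadrilateral Q, all vertices of Q but one have degree 4, and the third neighbour w of the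
    cubic vertex of Q is cubic.  Grinberg's criterion modulo 3 suggests that neither J nor J - w
    is hamiltonian; here this is established by dynamic programming over the edges.  There are
    such graphs on 36, 39, 42 and 45 vertices, one for each residue modulo 4.

    Thomassen's operation on a 4-cycle abcd deletes ab and cd and adds a new 4-cycle a'b'c'd'
    together with aa', bb', cc', dd'.  Applied repeatedly, starting from Q, it adds four vertices
    at a time.  What a hamiltonian cycle can do on the four corners is described by nine states,
    and this set is stable under the operation, so the graphs stay non-hamiltonian.  Conversely a
    hamiltonian cycle of G - v is rerouted through the new corners.  For planarity Q is drawn as
    the outer square and the successive 4-cycles as concentric squares around it. *)

Require Import Defs.
From Stdlib Require Import Reals ZArith Lra Lia.
From mathcomp Require Import all_boot zify.

Set Implicit Arguments.
Unset Strict Implicit.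
Unset Printing Implicit Defensive.

(** * Path states of a hamiltonian cycle *)

(** Grinberg's formula asks that the faces inside and outside a hamiltonian cycle have equal sums of
    length minus 2. Modulo 3 a pentagon counts 0 and Q counts 2, so J has no such cycle. Deleting w
    merges three pentagons into a 9-gon, which counts 1; the cubic vertex of Q then has degree 2, so
    the cycle uses both of its edges, which separate Q from the 9-gon, and 1 - 2 is not 0 modulo 3.
    By Euler's formula the order of such a J is a multiple of 3, and four consecutive multiples of 3
    meet all residues modulo 4. What shapes the formal argument is that the edges are never all
    treated, whereas the dynamic programming discards every selection that closes a cycle. This is
    legitimate only if the treated part cannot contain the whole cycle. The witness is the cubic
    corner of the outermost 4-cycle: its two sides on that 4-cycle are never treated, so it has at
    most one treated edge. The final contradiction is local: some other corner is left with no
    possible neighbour on the cycle except that one. *)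

Definition adj (L : seq (nat * nat)) (x y : nat) : bool :=
  ((x, y) \in L) || ((y, x) \in L).

Definition touches (L : seq (nat * nat)) (x : nat) : bool :=
  has (fun e => (e.1 == x) || (e.2 == x)) L.

Definition shift (t : nat) (e : nat * nat) := (t + e.1, t + e.2).

(** Repetitions are excluded in both directions so that the edge treated next by [run] is never
    among those already treated. *)
Fixpoint distinct (L : seq (nat * nat)) : bool :=
  if L is e :: L' then [&& e.1 != e.2, ~~ adj L' e.1 e.2 & distinct L'] else true.

Lemma adjC L x y : adj L x y = adj L y x.
Proof. by rewrite /adj orbC. Qed.

Lemma adj_cat L L' x y : adj (L ++ L') x y = adj L x y || adj L' x y.
Proof. by rewrite /adj !mem_cat -!orbA; do !bool_congr. Qed.

Lemma sub_adj L L' : {subset L <= L'} -> subrel (adj L) (adj L').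
Proof. by move=> LL' x y /orP[] /LL' h; rewrite /adj h ?orbT. Qed.

Lemma distinct_filter (P : pred (nat * nat)) L : distinct L -> distinct (filter P L).
Proof.
elim: L => //= e L IH /and3P[h1 h2 /IH h3]; case: ifP => //= _; rewrite h1 h3 andbT.
by apply: contraNN h2; apply: sub_adj => f; rewrite mem_filter => /andP[].
Qed.

Lemma adj_touches L x y : adj L x y -> touches L x.
Proof.
by case/orP=> h; apply/hasP; [exists (x, y) | exists (y, x)] => //=; rewrite eqxx ?orbT.
Qed.

Lemma adj_shift t L x y : adj (map (shift t) L) (t + x) (t + y) = adj L x y.
Proof.
have inj : injective (shift t) by case=> a b [c d] [/addnI-> /addnI->].
by rewrite /adj -[(t + x, _)]/(shift t (x, y)) -[(t + y, _)]/(shift t (y, x)) !mem_map.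
Qed.

Lemma touches_shift t L x : touches (map (shift t) L) (t + x) = touches L x.
Proof. by rewrite /touches has_map; apply: eq_has => e /=; rewrite !eqn_add2l. Qed.

(* A state records the traces on some vertices of a linear forest: [(x, Some x)] is an isolated
   vertex, [(x, Some y)] an end of a path whose other end is [y], [(x, None)] an inner vertex. *)
Definition state := seq (nat * option nat).

Fixpoint mate (st : state) (x : nat) : option nat :=
  if st is (u, m) :: st' then if u == x then m else mate st' x else None.

(** The path with ends [x'], [x] and the one with ends [y], [y'] are glued along the edge from [x]
    to [y]. The case [x' == x] is that of an isolated [x], which stays an end. *)
Definition relink (x x' y y' : nat) (p : nat * option nat) : nat * option nat :=
  (p.1, if p.1 == x then (if x' == x then Some y' else None)
        else if p.1 == y then (if y' == y then Some x' else None)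
        else if p.1 == x' then Some y'
        else if p.1 == y' then Some x' else p.2).

(* The ends of one path are never joined: that would close a cycle too early. *)
Definition join (x y : nat) (st : state) : seq state :=
  match mate st x, mate st y with
  | Some x', Some y' => if x' == y then [::] else [:: map (relink x x' y y') st]
  | _, _ => [::]
  end.

Definition forget (x : nat) (S : seq state) : seq state :=
  [seq filter (fun p => p.1 != x) st | st <- S & (x, None) \in st].

Definition retire (keep : seq nat) (rest : seq (nat * nat)) (x : nat) (S : seq state) :=
  if (x \in keep) || touches rest x then S else forget x S.

(* All states reachable by selecting some edges of [rest].  A vertex outside [keep] is dropped
   after its last edge, when only the states in which it is an inner vertex survive. *)
Fixpoint run (keep : seq nat) (rest : seq (nat * nat)) (S : seq state) : seq state :=
  if rest is (x, y) :: rest' then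
    run keep rest'
      (undup (retire keep rest' x (retire keep rest' y (S ++ flatten (map (join x y) S)))))
  else S.

Lemma mem_mate st x m : uniq (unzip1 st) -> (x, m) \in st -> mate st x = m.
Proof.
elim: st => //= -[u m'] st IH /= /andP[nu us]; rewrite in_cons => /predU1P[[-> ->]|h].
  by rewrite eqxx.
case: eqP => [e|_]; last exact: IH.
by case/negP: nu; rewrite e; apply/mapP; exists (x, m).
Qed.

(** * Soundness of the state computation with respect to a given cycle *)

Section Soundness.

Variable s : seq nat.
Hypothesis us : uniq s.
Hypothesis ss : 2 < size s.

Definition used (x y : nat) : bool :=
  (x \in s) && ((y == next s x) || (y == prev s x)).

(** For [x] on the cycle this sum of two booleans is the degree of [x] among the used edges of [L],
    because the two cycle neighbours differ ([next_neq_prev]). *)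
Definition deg (L : seq (nat * nat)) (x : nat) : nat :=
  adj L x (next s x) + adj L x (prev s x).

Lemma next_neq_prev (q : seq nat) x :
  uniq q -> 2 < size q -> x \in q -> next q x != prev q x.
Proof.
move=> uq sq xq; apply/eqP => E.
(* If the two neighbours coincided, two steps forward would return to [x]; with [x] rotated to the
   head, the third entry would equal the first. *)
have: next q (next q x) = x by rewrite E next_prev.
have [i q' Eq] := rot_to xq; rewrite -!(next_rot i uq).
move: uq sq; rewrite -(rot_uniq i) -(size_rot i q) Eq.
case: q' {Eq} => [|y [|z t]] //=; rewrite !inE !negb_or eqxx.
case/and3P=> /and3P[xy xz _] _ _ _; rewrite eq_sym (negPf xy) eqxx => Exz.
by rewrite Exz eqxx in xz.
Qed.

Lemma used_in x y : used x y -> x \in s.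
Proof. by case/andP. Qed.

Lemma usedC x y : used x y = used y x.
Proof.
have sym u v : used u v -> used v u.
  case/andP=> us_ /orP[]/eqP->; rewrite /used ?mem_next ?mem_prev us_ /=.
    by rewrite prev_next // eqxx orbT.
  by rewrite next_prev // eqxx.
by apply/idP/idP; apply: sym.
Qed.

Lemma used_neq x y : used x y -> x != y.
Proof.
move=> uxy; have ne := next_neq_prev us ss (used_in uxy).
have p1 : x != next s x.
  apply: contraNneq ne => E; have F : prev s x = x by rewrite {1}E prev_next.
  by rewrite F -E.
have p2 : x != prev s x.
  apply: contraNneq ne => E; have F : next s x = x by rewrite {1}E next_prev.
  by rewrite F -E.
by case/andP: uxy => _ /orP[]/eqP->.
Qed.

(** Once [s] is rotated to start at [x], the property spreads along the list from each entry to the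
    next. *)
Lemma next_closed (P : pred nat) x y :
  (forall u, u \in s -> P u -> P (next s u)) ->
  x \in s -> P x -> y \in s -> P y.
Proof.
move=> cl xs Px ys; have [i q E] := rot_to xs.
have: fcycle (next s) (rot i s) by rewrite rot_cycle; apply: cycle_next.
have: {subset rot i s <= s} by move=> u; rewrite mem_rot.
move: ys; rewrite -(mem_rot i) E /= inE rcons_path => yq sub /andP[pq _].
case/predU1P: yq => [-> //|yq].
elim: q x {xs E} Px yq sub pq => //= u q IH x Px yq sub; case/andP=> /eqP Eu pq.
have Pu : P u by rewrite -Eu; apply: cl => //; apply: sub; rewrite mem_head.
move: yq; rewrite inE => /predU1P[-> //|yq].
by apply: (IH u) => // v; rewrite inE => /predU1P[->|h]; apply: sub; rewrite !inE ?eqxx ?h ?orbT.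
Qed.

Definition lrel (L : seq (nat * nat)) : rel nat :=
  fun u v => used u v && adj L u v.

Definition linked (L : seq (nat * nat)) (x y : nat) : Prop :=
  exists2 p, path (lrel L) x p & last x p = y.

Lemma lrelC L x y : lrel L x y = lrel L y x.
Proof. by rewrite /lrel usedC adjC. Qed.

Lemma deg_mono L L' x : {subset L <= L'} -> deg L x <= deg L' x.
Proof.
move=> sub; apply: leq_add.
  by have := @sub_adj _ _ sub x (next s x); do 2!case: (adj _ _ _) => // /(_ isT).
by have := @sub_adj _ _ sub x (prev s x); do 2!case: (adj _ _ _) => // /(_ isT).
Qed.

(** Each vertex of [q] has two distinct neighbours along used edges, which must be its successor and
    predecessor on [s]. So [q] is closed under [next s] and contains all of [s]. *)
Lemma subcycle_deg L q z :
  uniq q -> 2 < size q -> cycle (lrel L) q -> z \in s -> deg L z = 2.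
Proof.
move=> uq sq cq zs.
have step u : u \in q -> lrel L u (next q u) /\ lrel L u (prev q u).
  by move=> uq_; split; [exact: next_cycle | rewrite lrelC; apply: prev_cycle].
have both u : u \in q -> [/\ adj L u (next s u), adj L u (prev s u) & next s u \in q].
  move=> uin; have [] := step u uin; have := next_neq_prev uq sq uin.
  have nq : next q u \in q by rewrite mem_next.
  have pq : prev q u \in q by rewrite mem_prev.
  move=> ne /andP[/andP[_ h1] a1] /andP[/andP[_ h2] a2].
  case/orP: h1 => /eqP h1; case/orP: h2 => /eqP h2; rewrite -?h1 -?h2 //.
    by rewrite h1 h2 eqxx in ne.
  by rewrite h1 h2 eqxx in ne.
have [u uin] : exists u, u \in q by case: (q) sq => // u ? _; exists u; rewrite mem_head.
have uS : u \in s by have [/andP[/used_in]] := step u uin.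
have zq : z \in q by apply: (next_closed (P := mem q) _ uS uin zs) => v _ /both[].
by have [h1 h2 _] := both z zq; rewrite /deg h1 h2.
Qed.

(** Joining the two ends of a path closes a cycle of used edges, hence all of [s]. The ban on such
    joins is thereby reduced to the degree of one vertex [z], which may be far away. *)
Lemma linked_closing L x y z :
  used x y -> ~~ adj L x y -> linked L x y -> z \in s -> deg ((x, y) :: L) z = 2.
Proof.
move=> uxy nxy [p0 /shortenP[p pp up _] lp].
have sub : subrel (lrel L) (lrel ((x, y) :: L)).
  move=> a b /andP[h1 h2]; rewrite /lrel h1.
  by apply: (sub_adj _ h2) => e; rewrite inE orbC => ->.
have xy : lrel ((x, y) :: L) x y by rewrite /lrel uxy /adj mem_head.
(* The path has at least three vertices: with one, the edge would be a loop, and with two, it would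
   already lie in [L]. *)
have p2 : 2 < size (x :: p).
  have ne := used_neq uxy.
  case: p pp up lp => [|u [|v p]] //=; first by move=> _ _ E; rewrite E eqxx in ne.
  by move=> /andP[/andP[_ h] _] _ E; rewrite -E h in nxy.
apply: subcycle_deg up p2 _ => /=.
by rewrite rcons_path (sub_path sub pp) lp lrelC.
Qed.

(* The keys of a state are vertices shifted down by [t]. *)
Definition valid (t : nat) (L : seq (nat * nat)) (st : state) : Prop :=
  uniq (unzip1 st) /\
  forall x m, (x, m) \in st -> t + x \in s /\
    if m is Some y then
      [/\ (y, Some x) \in st, linked L (t + x) (t + y) & deg L (t + x) = (x != y)]
    else deg L (t + x) = 2.

Lemma linked_sub L L' x y : {subset L <= L'} -> linked L x y -> linked L' x y.
Proof.
move=> sub [p pp lp]; exists p => //.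
by apply: sub_path pp => a b /andP[h1 h2]; rewrite /lrel h1 (sub_adj sub h2).
Qed.

Lemma linked_sym L x y : linked L x y -> linked L y x.
Proof.
move=> [p pp <-]; exists (rev (belast x p)).
  by rewrite rev_path; apply: sub_path pp => a b; rewrite lrelC.
by case: p {pp} => //= u p; rewrite rev_cons last_rcons.
Qed.

Lemma linked_trans L x y z : linked L x y -> linked L y z -> linked L x z.
Proof.
by move=> [p pp <-] [q pq <-]; exists (p ++ q); rewrite ?cat_path ?pp ?last_cat.
Qed.

Lemma linked_refl L x : linked L x x.
Proof. by exists [::]. Qed.

Lemma adj_cons x y L u v :
  adj ((x, y) :: L) u v = [|| (u == x) && (v == y), (u == y) && (v == x) | adj L u v].
Proof.
rewrite /adj !inE !xpair_eqE [in X in _ = X](orbCA _ _ (_ || _)) -!orbA.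
by rewrite [(v == x) && _]andbC; do !bool_congr.
Qed.

Lemma deg_skip x y L u : u \in s -> ~~ used x y -> deg ((x, y) :: L) u = deg L u.
Proof.
move=> uS nu; rewrite /deg !adj_cons.
have h v : used u v -> ((u == x) && (v == y) = false) /\ ((u == y) && (v == x) = false).
  move=> uv; split; apply/negP => /andP[/eqP E1 /eqP E2]; move: uv nu; rewrite E1 E2.
    by move->.
  by rewrite usedC => ->.
have [|-> ->] := h (next s u); first by rewrite /used uS eqxx.
by have [|-> ->] := h (prev s u); first by rewrite /used uS eqxx orbT.
Qed.

(** At either end the new edge leads to the successor or to the predecessor but not to both, so it
    adds exactly one. *)
Lemma deg_used x y L u : u \in s -> used x y -> ~~ adj L x y ->
  deg ((x, y) :: L) u = ((u == x) || (u == y)) + deg L u.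
Proof.
move=> uS uxy nxy; rewrite /deg !adj_cons.
have ne := next_neq_prev us ss uS; have xy := used_neq uxy.
case: (u =P x) => [E|/eqP nux]; first subst u.
  rewrite (negPf xy) !orbF /=; case/andP: (uxy) => _ /orP[]/eqP E; rewrite E eqxx /=.
    by rewrite -E in nxy ne *; rewrite eq_sym (negPf ne) (negPf nxy).
  by rewrite -E in nxy ne *; rewrite (negPf ne) (negPf nxy) addn0 addnC.
case: (u =P y) => [E|/eqP nuy] //=; subst u.
rewrite adjC in nxy; move: uxy; rewrite usedC => /andP[_ /orP[]/eqP E]; rewrite E eqxx /=.
  by rewrite -E in nxy ne *; rewrite eq_sym (negPf ne) (negPf nxy).
by rewrite -E in nxy ne *; rewrite (negPf ne) (negPf nxy) addn0 addnC.
Qed.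

Lemma valid_sub t L L' st : L =i L' -> valid t L st -> valid t L' st.
Proof.
move=> LL [u h]; split=> // x m /h[xs] H; split=> //.
have D v : deg L' v = deg L v by rewrite /deg /adj !LL.
case: m H => [y [h1 h2 h3]|]; rewrite D //; split=> //.
by apply: linked_sub h2 => e; rewrite LL.
Qed.

Lemma valid_skip t x y L st :
  ~~ used x y -> valid t L st -> valid t ((x, y) :: L) st.
Proof.
move=> nu [u h]; split=> // a m /h[aS H]; split=> //.
case: m H => [b [h1 h2 h3]|h3]; rewrite deg_skip //; split=> //.
by apply: linked_sub h2 => e; rewrite inE orbC => ->.
Qed.

Lemma valid_forget t x L st :
  (x, None) \in st -> valid t L st -> valid t L (filter (fun p => p.1 != x) st).
Proof.
move=> xst [u h]; split.
  by apply: subseq_uniq u; apply: map_subseq; apply: filter_subseq.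
move=> a m; rewrite mem_filter => /andP[/= ax /h[aS H]]; split=> //.
case: m H => [b [h1 h2 h3]|] //; split=> //.
rewrite mem_filter h1 andbT /=; apply: contraTneq h1 => ->.
by apply/negP => /(mem_mate u); rewrite (mem_mate u xst).
Qed.

Lemma valid_join t x y x' y' L st :
    used (t + x) (t + y) -> ~~ adj L (t + x) (t + y) ->
    (x, Some x') \in st -> (y, Some y') \in st -> x' != y -> valid t L st ->
  valid t ((t + x, t + y) :: L) (map (relink x x' y y') st).
Proof.
move=> uxy nxy xst yst nx'y [u h].
have xy : x != y by rewrite -(eqn_add2l t); apply: used_neq.
have sub : {subset L <= (t + x, t + y) :: L} by move=> e; rewrite inE orbC => ->.
have E : unzip1 (map (relink x x' y y') st) = unzip1 st.
  by rewrite /unzip1 -map_comp; apply: eq_map.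
split; first by rewrite E.
have [xS [x'st lx dx]] := h _ _ xst; have [yS [y'st ly dy]] := h _ _ yst.
have fn a m m' : (a, m) \in st -> (a, m') \in st -> m = m'.
  by move=> h1 h2; rewrite -(mem_mate u h1) -(mem_mate u h2).
(* Mates are mutual in a valid state, so from [x != y] and [x' != y] the only coincidences left
   among the four ends are [x = x'] and [y = y']. *)
have x'y' : x' != y'.
  apply: contraNneq xy => E'; move: x'st; rewrite E' => h1.
  by case: (fn _ _ _ h1 y'st) => ->.
have xy' : x != y'.
  apply: contraNneq nx'y => E'; move: y'st; rewrite -E' => h1.
  by case: (fn _ _ _ xst h1) => ->.
have lxy : linked ((t + x, t + y) :: L) (t + x') (t + y').
  apply: linked_trans (linked_sub sub ly); apply: linked_trans (linked_sym (linked_sub sub lx)) _.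
  by exists [:: t + y] => //=; rewrite /lrel uxy /adj mem_head.
have mem' a m : (a, m) \in st -> relink x x' y y' (a, m) \in map (relink x x' y y') st.
  exact: map_f.
have mx' : (x', Some y') \in map (relink x x' y y') st.
  have := mem' _ _ x'st; rewrite /relink /= eqxx (negPf nx'y).
  by case: (x' =P x) => [->|].
have my' : (y', Some x') \in map (relink x x' y y') st.
  have := mem' _ _ y'st; rewrite /relink /= eqxx [y' == x]eq_sym (negPf xy').
  rewrite [y' == x']eq_sym (negPf x'y').
  by case: (y' =P y) => [->|].
move=> a m /mapP[[a0 m0] am [Ea Em]]; rewrite /= in Ea Em; subst a0.
have [aS H] := h _ _ am; split=> //.
rewrite deg_used // !eqn_add2l.
case: (a =P x) Em => [Ea|/eqP ax].
  subst a; case: eqP => [E' ->|/eqP nx ->].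
    by rewrite E' eqxx in dx; rewrite E' in lxy my' *; split; rewrite ?dx ?xy' //; rewrite eq_sym.
  by rewrite dx [x == x']eq_sym nx.
case: (a =P y) => [Ea|/eqP ay].
  subst a; case: eqP => [E' ->|/eqP ny ->].
    rewrite E' eqxx in dy; rewrite E' in lxy mx' *; split; rewrite ?dy //; first exact: linked_sym.
    by rewrite eq_sym nx'y.
  by rewrite dy [y == y']eq_sym ny.
case: (a =P x') => [Ea ->|/eqP ax'].
  subst a; split=> //; have [_ [_ _ ->]] := h _ _ x'st.
  by rewrite ax x'y'.
case: (a =P y') => [Ea ->|/eqP ay' Em].
  subst a; split=> //; [exact: linked_sym | have [_ [_ _ ->]] := h _ _ y'st].
  by rewrite ay eq_sym x'y'.
subst m0; case: m am H => [b|] am //; case=> h1 h2 h3; split=> //; last exact: linked_sub h2.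
(* A bystander [a] keeps its mate [b]: were [b] one of the four ends, then so would be [a], again
   because mates are mutual. *)
have := mem' _ _ h1; rewrite /relink /=.
have nb c c' : (c, Some c') \in st -> a != c' -> b != c.
  by move=> cs; apply: contraNneq => E'; move: h1; rewrite E' => /fn/(_ cs)[->].
rewrite (negPf (nb _ _ xst ax')) (negPf (nb _ _ yst ay')).
by rewrite (negPf (nb _ _ x'st ax)) (negPf (nb _ _ y'st ay)).
Qed.

Lemma valid_fresh t L st x :
  valid t L st -> x \notin unzip1 st -> t + x \in s -> ~~ touches L (t + x) ->
  valid t L (rcons st (x, Some x)).
Proof.
move=> [u h] nx xs nt; split; first by rewrite /unzip1 map_rcons rcons_uniq nx.
have d0 : deg L (t + x) = 0.
  rewrite /deg; case: (boolP (adj _ _ _)) => [/adj_touches E|_]; first by rewrite E in nt.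
  by case: (boolP (adj _ _ _)) => [/adj_touches E|_] //; rewrite E in nt.
move=> a m; rewrite mem_rcons inE => /predU1P[[-> ->]|am].
  by split=> //; split; rewrite ?eqxx // ?mem_rcons ?mem_head //; exact: linked_refl.
have [aS H] := h _ _ am; split=> //; case: m H {am} => // b [h1 h2 h3]; split=> //.
by rewrite mem_rcons inE h1 orbT.
Qed.

Definition lower (c : nat) (st : state) : state :=
  [seq (p.1 - c, omap (subn^~ c) p.2) | p <- st].

(** Moving the origin up by [c] lets every stage speak of corners 0 to 3, so that one table of
    states serves them all. The bound on the keys makes the truncated subtraction exact. *)
Lemma valid_lower t c L st :
  all (fun p => c <= p.1) st -> valid t L st -> valid (t + c) L (lower c st).
Proof.
move=> /allP cst [u h]; split.
  rewrite /unzip1 /lower -map_comp -[map _ _]/(map (subn^~ c \o fst) st) map_comp.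
  rewrite map_inj_in_uniq //.
  move=> a b /mapP[p /cst pc ->] /mapP[q /cst qc ->] E.
  by rewrite -(subnK pc) E subnK.
move=> a m /mapP[[a0 m0] am [-> ->]] /=; have c0 : c <= a0 := cst _ am.
have ta : t + c + (a0 - c) = t + a0 by rewrite -addnA subnKC.
rewrite ta; have [aS H] := h _ _ am; split=> //; case: m0 am H => [b|] //= am [h1 h2 h3].
have cb : c <= b := cst _ h1; have tb : t + c + (b - c) = t + b by rewrite -addnA subnKC.
rewrite tb; split=> //; first by apply/mapP; exists (b, Some a0).
by rewrite h3; congr (nat_of_bool (~~ _)); clear -c0 cb; lia.
Qed.

(* The vertex [z] of the cycle has at most one edge in [M], so the edges of [M] cannot close it. *)
Section Run.
Variables (t z : nat) (keep : seq nat) (M : seq (nat * nat)).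
Hypothesis zS : z \in s.
Hypothesis zM : deg M z < 2.

(** The last conjunct is there because [run] retires both ends of an edge in turn: the second must
    still find its trace after the first has been dropped. *)
Lemma retire_sound L rest x S st :
    (x \notin keep -> ~~ touches rest x -> (x, None) \in st) ->
    st \in S -> valid t L st ->
  exists2 st', st' \in retire keep rest x S &
    valid t L st' /\
    {subset unzip1 st' <= unzip1 st} /\
    (forall u m, (u, m) \in st -> [|| u != x, x \in keep | touches rest x] -> (u, m) \in st').
Proof.
move=> xn stS v; rewrite /retire; case: ifPn => [_|]; first by exists st => //; split=> //; split.
rewrite negb_or => /andP[nk nt]; have xst := xn nk nt.
exists (filter (fun p => p.1 != x) st).
  by apply/mapP; exists st => //; rewrite mem_filter xst.
split; first exact: valid_forget.
split; first by move=> u /mapP[p]; rewrite mem_filter => /andP[_ ps] ->; apply: map_f.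
by move=> u m um; rewrite orbF mem_filter um => ->.
Qed.

(** The cycle itself dictates which edges to select, and the branch of [run] that follows it
    survives. The last hypothesis guarantees that a vertex to be dropped has met both of its cycle
    edges by then. *)
Lemma run_sound rest : forall L S st,
    st \in S -> valid t L st ->
    {subset L <= M} -> {subset map (shift t) rest <= M} ->
    (forall x, touches rest x -> x \in unzip1 st) ->
    distinct rest -> (forall x y, (x, y) \in rest -> ~~ adj L (t + x) (t + y)) ->
    (forall x y, x \in unzip1 st -> x \notin keep -> used (t + x) y ->
       adj (map (shift t) rest ++ L) (t + x) y) ->
  exists2 st', st' \in run keep rest S & valid t (map (shift t) rest ++ L) st'.
Proof.
elim: rest => [|[x y] rest IH] L S st stS v LM rM tk; first by exists st.
move=> /= /and3P[xy nxy dr] nL full.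
set L1 := (t + x, t + y) :: L.
have L1M : {subset L1 <= M}.
  by move=> e; rewrite inE => /predU1P[->|/LM //]; apply: rM; rewrite mem_head.
have nxL : ~~ adj L (t + x) (t + y) by apply: nL; rewrite mem_head.
have kx : x \in unzip1 st by apply: tk; rewrite /touches /= eqxx.
have ky : y \in unzip1 st by apply: tk; rewrite /touches /= eqxx orbT.
have [st1 st1S [v1 k1]] : exists2 st1, st1 \in S ++ flatten (map (join x y) S) &
    valid t L1 st1 /\ unzip1 st1 = unzip1 st.
  case: (boolP (used (t + x) (t + y))) => [uxy|nu]; last first.
    by exists st; [rewrite mem_cat stS | split; [exact: valid_skip|]].
  (* A used edge outside [L] leaves its ends with degree at most 1 in [L], so neither of them is an
     inner vertex yet. *)
  have some a : a \in unzip1 st -> t + a = t + x \/ t + a = t + y -> exists a', (a, Some a') \in st.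
    case/mapP=> -[a0 [a'|]] am /= -> E; first by exists a'.
    have [aS D] := v.2 _ _ am.
    have := deg_used aS uxy nxL; rewrite D; have -> : (t + a0 == t + x) || (t + a0 == t + y).
      by case: E => /= ->; rewrite eqxx ?orbT.
    by rewrite /deg; do 2!case: (adj _ _ _).
  have [x' xx'] := some x kx (or_introl erefl); have [y' yy'] := some y ky (or_intror erefl).
  (* A premature closure would give [z] degree 2 within [M], against [zM]. *)
  have nx'y : x' != y.
    apply/eqP => E; have [_ [_ lk _]] := v.2 _ _ xx'.
    have := deg_mono z L1M; rewrite (linked_closing uxy nxL _ zS) -?E //.
    by rewrite leqNgt zM.
  exists (map (relink x x' y y') st).
    rewrite mem_cat; apply/orP; right; apply/flattenP; exists (join x y st); first exact: map_f.
    by rewrite /join (mem_mate v.1 xx') (mem_mate v.1 yy') (negPf nx'y) mem_head.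
  split; first exact: valid_join.
  by rewrite /unzip1 -map_comp; apply: eq_map.
have adjE a b : adj (map (shift t) ((x, y) :: rest) ++ L) a b = adj (map (shift t) rest ++ L1) a b.
  by rewrite /= -cat_rcons /adj !(mem_cat, inE, mem_rcons) -!orbA; do !bool_congr.
(* With no edge at [a] left in [rest], both cycle edges at [a] lie in [L1]; the degree 2 is
   compatible with the trace [None] only. *)
have dead a : a \in unzip1 st -> a \notin keep -> ~~ touches rest a -> (a, None) \in st1.
  move=> ka nk nt; have : a \in unzip1 st1 by rewrite k1.
  case/mapP=> -[a0 m] am /= E; subst a0.
  have [aS D] := v1.2 _ _ am.
  suff d2 : deg L1 (t + a) = 2.
    case: m am D => // b _ [_ _]; rewrite d2; by case: (_ != _).
  have fa b : used (t + a) b -> adj L1 (t + a) b.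
    move=> uab; have := full _ _ ka nk uab; rewrite adjE adj_cat => /orP[/adj_touches|//].
    by rewrite touches_shift (negPf nt).
  by rewrite /deg !fa // /used aS eqxx ?orbT.
have [st2 st2S [v2 [k2 m2]]] := retire_sound (dead y ky) st1S v1.
have [st3 st3S [v3 [k3 m3]]] : exists2 st', st' \in retire keep rest x (retire keep rest y
      (S ++ flatten (map (join x y) S))) & valid t L1 st' /\ {subset unzip1 st' <= unzip1 st2} /\
    (forall u m, (u, m) \in st2 -> [|| u != x, x \in keep | touches rest x] -> (u, m) \in st').
  apply: retire_sound st2S v2 => nk nt; apply: m2; first exact: dead.
  by rewrite xy.
set S1 := retire _ _ x _ in st3S *.
suff [st4 h4 v4] : exists2 st', st' \in run keep rest (undup S1) &
    valid t (map (shift t) rest ++ L1) st'.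
  exists st4 => //.
  by apply: valid_sub v4 => e; rewrite /= !(mem_cat, inE); do !bool_congr.
apply: (IH L1 _ st3) => //.
- by rewrite mem_undup.
- by move=> e he; apply: rM; rewrite inE he orbT.
- move=> a ta; have : a \in unzip1 st1 by rewrite k1 tk // /touches /= -/(touches rest a) ta orbT.
  case/mapP=> -[a0 m] am /= E; subst a0.
  have h : (a, m) \in st3.
    apply: m3; first apply: m2 => //.
      by case: (a =P y) => //= <-; rewrite ta orbT.
    by case: (a =P x) => //= <-; rewrite ta orbT.
  by apply/mapP; exists (a, m).
- move=> a b ab; rewrite adj_cons !eqn_add2l orbA negb_or nL ?andbT; last by rewrite inE ab orbT.
  by apply: contraNN nxy => /orP[]/andP[/eqP<- /eqP<-]; rewrite /adj ab ?orbT.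
- move=> a b ka nk uab; rewrite -adjE; apply: full => //.
  by rewrite -k1; apply: k2; apply: k3.
Qed.
End Run.
End Soundness.

(** * Thomassen's operation and non-hamiltonicity *)

Definition rungs := [:: (0, 3); (1, 2)].
Definition spokes := [:: (0, 4); (1, 5); (2, 6); (3, 7)].
Definition caps := [:: (0, 1); (2, 3)].

(* The states on the four corners produced by each of the four base graphs below. *)
Definition corner_states : seq state :=
  [:: [:: (0, Some 0); (1, Some 2); (2, Some 1); (3, None)];
      [:: (0, Some 0); (1, Some 3); (2, Some 2); (3, Some 1)];
      [:: (0, Some 0); (1, None); (2, Some 3); (3, Some 2)];
      [:: (0, Some 1); (1, Some 0); (2, Some 2); (3, None)];
      [:: (0, Some 1); (1, Some 0); (2, None); (3, Some 3)];
      [:: (0, Some 2); (1, Some 1); (2, Some 0); (3, Some 3)];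
      [:: (0, Some 2); (1, None); (2, Some 0); (3, None)];
      [:: (0, Some 3); (1, Some 1); (2, None); (3, Some 0)];
      [:: (0, Some 3); (1, None); (2, Some 2); (3, Some 0)]].

Lemma corner_states_keys st : st \in corner_states -> unzip1 st = [:: 0; 1; 2; 3].
Proof.
have: all (fun st => unzip1 st == [:: 0; 1; 2; 3]) corner_states by vm_compute.
by move/allP => h /h /eqP.
Qed.

Definition isolated (ks : seq nat) : state := [seq (x, Some x) | x <- ks].

(** This is one application of the operation: corners 0 to 3 are retired, 4 to 7 take over, and the
    caps are missing because the operation deletes them. *)
Lemma corner_states_layer st :
  st \in run [:: 4; 5; 6; 7] (rungs ++ spokes)
             [seq st ++ isolated [:: 4; 5; 6; 7] | st <- corner_states] ->
  all (fun p => 4 <= p.1) st /\ lower 4 st \in corner_states.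
Proof.
have: all (fun st => all (fun p => 4 <= p.1) st && (lower 4 st \in corner_states))
  (run [:: 4; 5; 6; 7] (rungs ++ spokes)
       [seq st ++ isolated [:: 4; 5; 6; 7] | st <- corner_states]) by vm_compute.
by move/allP => h /h /andP.
Qed.

(** At the last stage corners 1 and 3 have, beyond these edges, only the side leading to corner 0.
    One that is still isolated here can no longer reach degree 2. *)
Lemma corner_states_final st :
  st \in run [:: 0; 1; 3] [:: (1, 2); (2, 3)] corner_states ->
  ((1, Some 1) \in st) || ((3, Some 3) \in st).
Proof.
have: all (fun st => ((1, Some 1) \in st) || ((3, Some 3) \in st))
  (run [:: 0; 1; 3] [:: (1, 2); (2, 3)] corner_states) by vm_compute.
by move/allP => h /h.
Qed.

Section Family.

Variables (t0 w : nat) (E0 : seq (nat * nat)).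

(* [level k + i] for [i < 4] are the corners at stage [k].  The edges of the 4-cycle on them are
   missing in [skel k]; [frame k] has two opposite ones, [tower k] all four. *)
Definition level (k : nat) := t0 + 4 * k.

Fixpoint skel (k : nat) : seq (nat * nat) :=
  if k is j.+1 then skel j ++ map (shift (level j)) (rungs ++ spokes) else E0.

Definition frame (k : nat) := skel k ++ map (shift (level k)) rungs.

Definition tower (k : nat) := frame k ++ map (shift (level k)) caps.

Lemma levelS k : level k.+1 = level k + 4.
Proof. by rewrite /level; lia. Qed.

(** Stages are added outwards, so a vertex below [level j] receives no edge after [skel j]. This is
    what permits retiring it. *)
Lemma tower_split j k (e : nat * nat) : j <= k -> e \in tower k ->
  e \in skel j \/ level j <= e.1 /\ level j <= e.2.
Proof.
have skS m : e \in skel (j + m) -> e \in skel j \/ level j <= e.1 /\ level j <= e.2.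
  elim: m => [|m IH]; first by rewrite addn0; left.
  rewrite addnS /= mem_cat => /orP[/IH //|].
  by rewrite /= !inE => /or4P[|||/or3P[]] /eqP-> /=; right; rewrite /level; lia.
move=> jk; rewrite /tower /frame -catA !mem_cat; case/orP => [|h].
  by rewrite -{1}(subnKC jk); apply: skS.
right; move: h; rewrite /= !inE => /orP[/orP[]|/orP[]] /eqP-> /=; rewrite /level; lia.
Qed.

Lemma skel_mono j k : j <= k -> {subset skel j <= skel k}.
Proof.
move=> jk; rewrite -(subnKC jk); elim: (k - j) => [|m IH] e; first by rewrite addn0.
by rewrite addnS /= mem_cat => /IH ->.
Qed.

(** A corner occurs only as second component, which rules out edges between corners; the implication
    makes [t0] the cubic corner, with third neighbour [w]. *)
Hypothesis E0P : all (fun e => [&& e.1 < t0, e.2 < t0 + 4 & (e.2 == t0) ==> (e.1 == w)]) E0.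

Lemma skel_bound k (e : nat * nat) : e \in skel k -> e.1 < level k /\ e.2 < level k + 4.
Proof.
elim: k e => [|k IH] e /=.
  by move/(allP E0P)=> /and3P[h1 h2 _]; rewrite /level; lia.
rewrite mem_cat levelS => /orP[/IH[h1 h2]|]; first by lia.
by rewrite /= !inE => /or4P[|||/or3P[]] /eqP-> /=; lia.
Qed.

(** * Refutation of a cycle through all vertices of a tower, or all but [w] *)

Section Cycle.
Hypothesis E0d : distinct E0.
Variables (k : nat) (s : seq nat).
Hypothesis us : uniq s.
Hypothesis ss : 2 < size s.
Hypothesis cs : cycle (adj (tower k)) s.
Hypothesis inS : forall x, t0 <= x -> x < level k + 4 -> x \in s.

Lemma used_adj x y : used s x y -> adj (tower k) x y.
Proof.
by case/andP=> xs /orP[]/eqP->; [exact: next_cycle | rewrite adjC; exact: prev_cycle].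
Qed.

Lemma used_low j x y : j <= k -> x < level j -> used s x y -> adj (skel j) x y.
Proof.
move=> jk xj /used_adj /orP[] /(tower_split jk) [h|[/= h1 h2]]; rewrite /adj ?h ?orbT //; lia.
Qed.

(** Every edge list handed to [run] below lies in [M], which omits the two sides of the outermost
    4-cycle at its corner 0. *)
Let M := skel k ++ map (shift (level k)) [:: (1, 2); (2, 3)].

Lemma corner_in : level k \in s.
Proof. by apply: inS; rewrite /level; lia. Qed.

(** Within [M] the only possible neighbour of this corner is [w] at stage 0, and corner 0 of the
    preceding stage afterwards. *)
Lemma corner_deg : deg s M (level k) < 2.
Proof.
have [u Hu] : exists u, forall y, adj M (level k) y -> y = u.
  have bd x y : adj (map (shift (level k)) [:: (1, 2); (2, 3)]) x y -> x != level k.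
    rewrite adjC /adj /= !inE !xpair_eqE.
    by case/orP=> /orP[]/andP[/eqP E1 /eqP E2]; apply/eqP; rewrite /= in E1 E2; lia.
  rewrite /M; case: k bd => [|j] bd.
    exists w => y; rewrite adj_cat => /orP[|/bd]; last by rewrite eqxx.
    case/orP => /(allP E0P) /= /and3P[h1 h2 h3]; first by move: h1; rewrite /level; lia.
    by move: h3; rewrite /level muln0 addn0 eqxx => /eqP.
  exists (level j) => y; rewrite adj_cat => /orP[|/bd]; last by rewrite eqxx.
  rewrite /= adj_cat => /orP[/orP[] /skel_bound /=|]; rewrite ?levelS; [lia|lia|].
  rewrite /adj /= !inE !xpair_eqE /=; lia.
rewrite /deg; case: (boolP (adj _ _ _)) => h1; case: (boolP (adj _ _ _)) => h2 //.
have := next_neq_prev us ss corner_in.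
by rewrite (Hu _ h1) (Hu _ h2) eqxx.
Qed.

Let keep0 := [:: t0; t0 + 1; t0 + 2; t0 + 3].

(** The parameters [E] and [ks] allow both uses: the whole base graph, and the base graph without
    [w]. *)
Lemma base_sound E ks :
    {subset E <= E0} -> distinct E -> uniq ks ->
    (forall x, x \in ks -> x \in s /\ x < t0 + 4) ->
    (forall x, touches E x -> x \in ks) ->
    (forall x y, x \in s -> y \in s -> adj E0 x y -> adj E x y) ->
  exists2 st, st \in run keep0 E [:: isolated ks] & valid s 0 E st.
Proof.
move=> EE dE uks ksP tE full.
have sh L : map (shift 0) L = L by apply: map_id_in => -[].
have uz : unzip1 (isolated ks) = ks by rewrite /unzip1 /isolated -map_comp map_id_in.
have v0 : valid s 0 [::] (isolated ks).
  split; rewrite ?uz // => x m /mapP[y yk [-> ->]]; split; first by have [] := ksP y yk.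
  by split; [apply: map_f | exact: linked_refl | rewrite eqxx].
have E0M : {subset E <= M}.
  by move=> e /EE h; rewrite mem_cat (@skel_mono 0 k).
have := @run_sound s us ss 0 (level k) keep0 M corner_in corner_deg E [::]
  [:: isolated ks] (isolated ks).
rewrite sh cats0; apply=> //; rewrite ?mem_head ?uz //.
move=> x y /ksP[_ xt] xk uxy; rewrite !add0n in uxy *.
apply: full; [exact: used_in uxy | by rewrite usedC // in uxy; exact: used_in uxy|].
apply: (@used_low 0) => //; rewrite /level muln0 addn0.
by move: xk xt; rewrite !inE; lia.
Qed.

(** Without [w] no state on the corners survives even the base graph, so nothing added outside it
    can help, whatever [k] is. *)
Lemma tower_minus_nonham :
    w \notin s -> (forall x, x < t0 + 4 -> x != w -> x \in s) ->
    run keep0 [seq e <- E0 | (e.1 != w) && (e.2 != w)]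
        [:: isolated [seq x <- iota 0 (t0 + 4) | x != w]] = [::] ->
  False.
Proof.
move=> ws sin R0; set E := [seq e <- E0 | _] in R0.
have EE : {subset E <= E0} by move=> e; rewrite mem_filter => /andP[].
have [|||||st] := @base_sound E [seq x <- iota 0 (t0 + 4) | x != w] EE; last by rewrite R0.
- exact: distinct_filter.
- by rewrite filter_uniq // iota_uniq.
- by move=> x; rewrite mem_filter mem_iota /= add0n => /andP[xw xt]; split=> //; apply: sin.
- move=> x /hasP[[a b]]; rewrite {1}/E mem_filter => /andP[/andP[/= aw bw]].
  move=> /(allP E0P) /and3P[/= h1 h2 _] /orP[]/eqP<-;
    rewrite mem_filter mem_iota add0n ?aw ?bw ?h2 //=.
  by rewrite ltn_addr.
- move=> x y xs ys; have [xw yw] : x != w /\ y != w.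
    by split; [apply: contraNneq ws => <- | apply: contraNneq ws => <-].
  by case/orP=> h; rewrite /adj !mem_filter /= xw yw h ?orbT.
Qed.

Hypothesis base_run :
  all (fun st => all (fun p => t0 <= p.1) st && (lower t0 st \in corner_states))
      (run keep0 E0 [:: isolated (iota 0 (t0 + 4))]).
Hypothesis all_in : forall x, x < t0 + 4 -> x \in s.

Lemma level_sound j : j <= k ->
  exists2 st, st \in corner_states & valid s (level j) (skel j) st.
Proof.
elim: j => [_|j IH jk].
  have [||||||st stS v] := @base_sound E0 (iota 0 (t0 + 4)) => //; first exact: iota_uniq.
  - by move=> x; rewrite mem_iota /= add0n => xt; split=> //; apply: all_in.
  - move=> x /hasP[[a b] /(allP E0P) /and3P[/= h1 h2 _] /orP[]/eqP<-]; rewrite mem_iota /=.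
      by apply: ltn_trans h1 _; rewrite -{1}[t0]addn0 ltn_add2l.
    exact: h2.
  have /andP[h1 h2] := allP base_run _ stS.
  exists (lower t0 st) => //; have := valid_lower h1 v; by rewrite /level muln0 addn0.
have [st stS v] := IH (ltnW jk); have kst := corner_states_keys stS.
have fr x : 4 <= x < 8 -> level j + x \in s /\ ~~ touches (skel j) (level j + x).
  move=> xP; split.
    by apply: inS; move: jk; rewrite /level; lia.
  by apply/hasPn => -[a b] /skel_bound[/= h1 h2]; lia.
(* The four corners of the next stage, untouched by [skel j], enter as isolated vertices. *)
have [st1 E1 v1] : exists2 st1, st1 = st ++ isolated [:: 4; 5; 6; 7] &
    valid s (level j) (skel j) st1.
  exists (st ++ isolated [:: 4; 5; 6; 7]) => //=.
  rewrite -!cat_rcons cats0; do 4!(apply: valid_fresh;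
    [|by rewrite /unzip1 ?map_rcons -/(unzip1 _) kst|by apply: (fr _ _).1|by apply: (fr _ _).2]).
  exact: v.
have k1 : unzip1 st1 = [:: 0; 1; 2; 3; 4; 5; 6; 7] by rewrite E1 /unzip1 map_cat -/(unzip1 st) kst.
have [||||||||st2 h2 v2] :=
  @run_sound s us ss (level j) (level k) [:: 4; 5; 6; 7] M corner_in corner_deg (rungs ++ spokes) (skel j) [seq st ++ isolated [:: 4; 5; 6; 7] | st <- corner_states] st1.
- by rewrite E1; apply/mapP; exists st.
- exact: v1.
- by move=> e h; rewrite mem_cat (@skel_mono j k) // ltnW.
- by move=> e h; rewrite mem_cat (@skel_mono j.+1 k) //= mem_cat h orbT.
- by move=> x; rewrite k1 /touches /= !inE; lia.
- by [].
- move=> x y xy; apply/negP => h.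
  have {h} : level j + x < level j \/ level j + y < level j.
    by case/orP: h => /skel_bound[]; auto.
  lia.
- move=> x y; rewrite k1 => xk nk uxy.
  rewrite adj_cat orbC -adj_cat; apply: (@used_low j.+1) => //.
  by move: xk nk; rewrite levelS !inE; lia.
have [h3 h4] := corner_states_layer h2.
exists (lower 4 st2); first exact: h4.
rewrite levelS; apply: valid_sub (valid_lower h3 v2).
by move=> e; rewrite !mem_cat orbC.
Qed.

(** After [corner_states_final], corner 1 or corner 3 has no cycle edge in [M]. Its only other edge
    goes to [level k], so its successor and predecessor would coincide. *)
Lemma tower_nonham : False.
Proof.
have [st stS v] := level_sound (leqnn k); have kst := corner_states_keys stS.
have nsk x y : ~~ adj (skel k) (level k + x) (level k + y).
  by apply/negP => /orP[] /skel_bound[/= h _]; move: h; rewrite ltnNge leq_addr.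
have edges x y : used s (level k + x) y -> 
    adj (map (shift (level k)) [:: (1, 2); (2, 3)] ++ skel k) (level k + x) y ||
    [|| (x == 0), (x == 1) && (y == level k) | (x == 3) && (y == level k)].
  move=> /used_adj; rewrite /tower /frame -catA -map_cat !adj_cat.
  case/orP=> [->|]; first by rewrite orbT.
  by case/orP; rewrite /= !inE => /or4P[]/eqP[];
    (move=> /addnI-> -> || move=> -> /addnI->);
    rewrite ?(adj_shift _ [:: (1, 2); (2, 3)]) ?addn0 ?eqxx ?orbT.
have [||||||||st2 h2 v2] :=
  @run_sound s us ss (level k) (level k) [:: 0; 1; 3] M corner_in corner_deg [:: (1, 2); (2, 3)] (skel k) corner_states st.
- exact: stS.
- exact: v.
- by move=> e h; rewrite mem_cat h.
- by move=> e h; rewrite mem_cat h orbT.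
- by move=> x; rewrite kst /touches /= !inE; lia.
- by [].
- by [].
- move=> x y; rewrite kst => xk nk /edges.
  by have -> : x = 2; [move: xk nk; rewrite !inE; lia | rewrite orbF].
have dead x : (x, Some x) \in st2 -> (x == 1) || (x == 3) -> False.
  move=> xst x13; have [xS [_ _]] := v2.2 _ _ xst; rewrite eqxx /deg => d0.
  have only y : used s (level k + x) y ->
      adj (map (shift (level k)) [:: (1, 2); (2, 3)] ++ skel k) (level k + x) y || (y == level k).
    move=> /edges /orP[->//|].
    by case/orP: x13 => /eqP-> /= => [/orP[]|] // ->; rewrite orbT.
  have un : used s (level k + x) (next s (level k + x)) by rewrite /used xS eqxx.
  have up : used s (level k + x) (prev s (level k + x)) by rewrite /used xS eqxx orbT.
  have /orP[a1|/eqP E1] := only _ un; first by rewrite a1 in d0.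
  have /orP[a2|/eqP E2] := only _ up; first by rewrite a2 addn1 in d0.
  by have := next_neq_prev us ss xS; rewrite E1 E2 eqxx.
by case/orP: (corner_states_final h2) => /dead; apply.
Qed.

End Cycle.
End Family.

(** * Hamiltonian cycles of vertex-deleted graphs *)

Definition route (L : seq (nat * nat)) (x y : nat) (q : seq nat) : bool :=
  if q is u :: p then [&& u == x, path (adj L) u p & last u p == y] else false.

Lemma route_sub L L' x y q : {subset L <= L'} -> route L x y q -> route L' x y q.
Proof.
case: q => //= u p sub /and3P[-> pp ->]; rewrite andbT.
exact: sub_path (sub_adj sub) _ _ pp.
Qed.

Lemma route_cons L u x y q : adj L u x -> route L x y q -> route L u y (u :: q).
Proof. by case: q => //= v p ux /and3P[/eqP-> pp ->]; rewrite eqxx ux pp. Qed.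

Lemma route_rcons L u x y q : adj L y u -> route L x y q -> route L x u (rcons q u).
Proof.
case: q => //= v p yu /and3P[-> pp /eqP E].
by rewrite rcons_path pp E yu last_rcons eqxx.
Qed.

Lemma route_cycle L x y q : adj L y x -> route L x y q -> cycle (adj L) q.
Proof.
by case: q => //= v p yx /and3P[/eqP-> pp /eqP E]; rewrite rcons_path pp E.
Qed.

Lemma route_cat L x y x' y' q q' :
  adj L y x' -> route L x y q -> route L x' y' q' -> route L x y' (q ++ q').
Proof.
case: q q' => [|u p] [|u' p'] //= yx /and3P[-> pp /eqP E] /and3P[/eqP-> pp' E'].
by rewrite cat_path last_cat /= pp E yx pp' E'.
Qed.

Section Family.

Variables (t0 w : nat) (E0 : seq (nat * nat)).
Local Notation top := (level t0).
Local Notation frame := (frame t0 E0).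
Local Notation tower := (tower t0 E0).

Definition covering (k v : nat) (q : seq nat) : bool :=
  perm_eq (v :: q) (iota 0 (top k + 4)).

(* The ends of the routes are joined by edges of the outer 4-cycle to a hamiltonian cycle of the
   graph without [v]. *)
Variant spanned (k v : nat) : Prop :=
| Span01 q of route (frame k) (top k) (top k + 1) q & covering k v q
| Span32 q of route (frame k) (top k + 3) (top k + 2) q & covering k v q
| Span12_30 q q' of route (frame k) (top k + 1) (top k + 2) q
    & route (frame k) (top k + 3) (top k) q' & covering k v (q ++ q')
| Span01_23 q q' of route (frame k) (top k) (top k + 1) q
    & route (frame k) (top k + 2) (top k + 3) q' & covering k v (q ++ q').

Lemma skelS k : skel t0 E0 k.+1 =
  skel t0 E0 k ++ map (shift (top k)) rungs ++ map (shift (top k)) spokes.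
Proof. by []. Qed.

(** Routes live in [frame] rather than [tower] for this inclusion: the operation deletes the caps
    and keeps the rungs. *)
Lemma frameS k : {subset frame k <= frame k.+1}.
Proof.
by move=> e; rewrite /frame skelS !mem_cat => /orP[]->; rewrite ?orbT.
Qed.

Lemma frame_spoke k i : i < 4 ->
  adj (frame k.+1) (top k + i) (top k.+1 + i).
Proof.
move=> i4; rewrite levelS -addnA; rewrite /frame skelS !adj_cat !adj_shift.
by case: i i4 => [|[|[|[|i]]]] //; rewrite !orbT.
Qed.

Lemma frame_rung k : adj (frame k) (top k) (top k + 3) /\ adj (frame k) (top k + 1) (top k + 2).
Proof.
have h x y : adj rungs x y -> adj (frame k) (top k + x) (top k + y).
  by rewrite /frame adj_cat adj_shift => ->; rewrite orbT.
by split; [have := h 0 3 isT; rewrite addn0 | exact: h].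
Qed.

Lemma tower_cap k : adj (tower k) (top k) (top k + 1) /\ adj (tower k) (top k + 2) (top k + 3).
Proof.
have h x y : adj caps x y -> adj (tower k) (top k + x) (top k + y).
  by rewrite /tower adj_cat adj_shift => ->; rewrite orbT.
by split; [have := h 0 1 isT; rewrite addn0 | exact: h].
Qed.

(** To miss a new corner [v], one starts from routes missing an old corner [u] and inserts [u] on
    the way. *)
Lemma covering_swap k u v q q' :
  perm_eq (v :: q') ((u :: q) ++ [:: top k + 4; top k + 5; top k + 6; top k + 7]) ->
  covering k u q -> covering k.+1 v q'.
Proof.
rewrite /covering levelS (iotaD 0 (top k + 4) 4) add0n => h1 h2.
have -> : iota (top k + 4) 4 = [:: top k + 4; top k + 5; top k + 6; top k + 7].
  by rewrite /= !addnS.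
by rewrite (permPl h1) perm_cat2r.
Qed.

Lemma covering_step k v q q' :
  perm_eq q' (q ++ [:: top k + 4; top k + 5; top k + 6; top k + 7]) ->
  covering k v q -> covering k.+1 v q'.
Proof. by move=> h; apply: covering_swap; rewrite perm_cons. Qed.

Local Notation a k := (top k).
Local Notation b k := (top k + 1).
Local Notation c k := (top k + 2).
Local Notation d k := (top k + 3).

Lemma frame_link k : [/\ adj (frame k.+1) (a k) (a k.+1), adj (frame k.+1) (b k) (b k.+1),
  adj (frame k.+1) (c k) (c k.+1) & adj (frame k.+1) (d k) (d k.+1)].
Proof.
have h := @frame_spoke k; split; try exact: h.
by have := h 0 isT; rewrite !addn0.
Qed.

(** Two lists are permutations if every predicate has the same count on both. With counts and
    booleans generalized to naturals, that is linear arithmetic. *)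
Ltac perm_tac :=
  apply/permP => P; rewrite -?cats1 ?levelS /= ?count_cat /= ?count_cat /= ?addnS ?addn0;
  repeat match goal with |- context [nat_of_bool ?b] => move: (nat_of_bool b) end;
  move: (count _ _); repeat match goal with |- context [count _ ?q] => move: (count _ q) end;
  clear; lia.

(** A single route is prolonged at each end by a spoke and then a rung, which turns ends a, b into
    d', c' and ends d, c into a', b'. A pair of routes is prolonged by the four spokes and keeps its
    type. *)
Lemma spanned_step k v : spanned k v -> spanned k.+1 v.
Proof.
have [ha hb hc hd] := frame_link k; have [r1 r2] := frame_rung k.+1.
have sub := @frameS k.
case=> [q /(route_sub sub) rq cq|q /(route_sub sub) rq cq
       |q q' /(route_sub sub) rq /(route_sub sub) rq' cq
       |q q' /(route_sub sub) rq /(route_sub sub) rq' cq].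
- apply: (@Span32 _ _ (d k.+1 :: a k.+1 :: rcons (rcons q (b k.+1)) (c k.+1))).
    apply: route_cons; first by rewrite adjC; exact: r1.
    by apply: route_cons (route_rcons r2 (route_rcons hb rq)); rewrite adjC.
  by apply: covering_step cq; perm_tac.
- apply: (@Span01 _ _ (a k.+1 :: d k.+1 :: rcons (rcons q (c k.+1)) (b k.+1))).
    apply: route_cons r1 _; apply: route_cons; first by rewrite adjC; exact: hd.
    apply: route_rcons; first by rewrite adjC; exact: r2.
    exact: route_rcons hc rq.
  by apply: covering_step cq; perm_tac.
- apply: (@Span12_30 _ _ (b k.+1 :: rcons q (c k.+1)) (d k.+1 :: rcons q' (a k.+1))).
  + by apply: route_cons (route_rcons hc rq); rewrite adjC.
  + by apply: route_cons (route_rcons ha rq'); rewrite adjC.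
  by apply: covering_step cq; perm_tac.
- apply: (@Span01_23 _ _ (a k.+1 :: rcons q (b k.+1)) (c k.+1 :: rcons q' (d k.+1))).
  + by apply: route_cons (route_rcons hb rq); rewrite adjC.
  + by apply: route_cons (route_rcons hd rq'); rewrite adjC.
  by apply: covering_step cq; perm_tac.
Qed.

(** [spanned_step] says nothing about a vertex that has just been added. For these the induction
    needs to know on which side the route ends, namely opposite to the missing corner. *)
Definition corners_spanned k : Prop :=
  (forall v, v \in [:: a k; b k] ->
     exists2 q, route (frame k) (d k) (c k) q & covering k v q) /\
  (forall v, v \in [:: c k; d k] ->
     exists2 q, route (frame k) (a k) (b k) q & covering k v q).

(** Missing a': d' d ... c b b' c', from the route missing b. Missing b': d' a' a d ... c c', from
    the route missing a. The cases c' and d' are the mirror images. *)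
Lemma corners_step k : corners_spanned k -> corners_spanned k.+1.
Proof.
have [ha hb hc hd] := frame_link k; have [r1 r2] := frame_rung k.+1.
have sub := @frameS k; have [s1 s2] := frame_rung k.
have {s1 s2}[s1 s2] := (sub_adj sub s1, sub_adj sub s2).
case=> dc ab; split=> v; rewrite !inE => /orP[]/eqP->.
- have [|q /(route_sub sub) rq cq] := dc (b k); first by rewrite !inE eqxx orbT.
  exists (d k.+1 :: rcons (rcons (rcons q (b k)) (b k.+1)) (c k.+1)).
    apply: route_cons; first by rewrite adjC; exact: hd.
    apply: route_rcons r2 _; apply: route_rcons hb _.
    by apply: route_rcons rq; rewrite adjC.
  by apply: covering_swap cq; perm_tac.
- have [|q /(route_sub sub) rq cq] := dc (a k); first by rewrite !inE eqxx.
  exists (d k.+1 :: a k.+1 :: a k :: rcons q (c k.+1)).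
    apply: route_cons; first by rewrite adjC; exact: r1.
    apply: route_cons; first by rewrite adjC; exact: ha.
    by apply: route_cons s1 _; apply: route_rcons hc rq.
  by apply: covering_swap cq; perm_tac.
- have [|q /(route_sub sub) rq cq] := ab (d k); first by rewrite !inE eqxx orbT.
  exists (a k.+1 :: d k.+1 :: d k :: rcons q (b k.+1)).
    apply: route_cons r1 _; apply: route_cons; first by rewrite adjC; exact: hd.
    apply: route_cons; first by rewrite adjC; exact: s1.
    exact: route_rcons hb rq.
  by apply: covering_swap cq; perm_tac.
- have [|q /(route_sub sub) rq cq] := ab (c k); first by rewrite !inE eqxx.
  exists (a k.+1 :: rcons (rcons (rcons q (c k)) (c k.+1)) (b k.+1)).
    apply: route_cons; first by rewrite adjC; exact: ha.
    apply: route_rcons; first by rewrite adjC; exact: r2.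
    by apply: route_rcons hc _; apply: route_rcons s2 rq.
  by apply: covering_swap cq; perm_tac.
Qed.

Lemma corners_spanned_all k v :
  corners_spanned k -> top k <= v -> v < top k + 4 -> spanned k v.
Proof.
move=> [dc ab] tv vt; have: v \in [:: a k; b k; c k; d k] by rewrite !inE; lia.
rewrite -[[:: _; _; _; _]]/([:: a k; b k] ++ [:: c k; d k]) mem_cat.
by case/orP=> [/dc|/ab] [q rq cq]; [exact: Span32 rq cq | exact: Span01 rq cq].
Qed.

(** The side conditions on [v] make a corner admissible only with a single route ending on the
    opposite side, as [corners_spanned] demands at stage 0. *)
Definition spanned_by (v : nat) (qs : seq (seq nat)) : bool :=
  match qs with
  | [:: q] => covering 0 v q &&
      ((route (frame 0) (a 0) (b 0) q && (v \notin [:: a 0; b 0])) ||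
       (route (frame 0) (d 0) (c 0) q && (v \notin [:: c 0; d 0])))
  | [:: q; q'] => [&& v < t0, covering 0 v (q ++ q') &
      (route (frame 0) (b 0) (c 0) q && route (frame 0) (d 0) (a 0) q') ||
      (route (frame 0) (a 0) (b 0) q && route (frame 0) (c 0) (d 0) q')]
  | _ => false
  end.

Hypothesis covP : forall v, v < t0 + 4 -> v != w -> exists qs, spanned_by v qs.
Hypothesis wt : w < t0.

Lemma spanned_all k v : v < top k + 4 -> v != w -> spanned k v.
Proof.
have top0 : top 0 = t0 by rewrite /level muln0 addn0.
suff [H C] : (forall v, v < top k + 4 -> v != w -> spanned k v) /\ corners_spanned k.
  exact: H.
elim: k {v} => [|k [IH C]]; last first.
  have C' := corners_step C; split=> // v vt vw.
  have [vk|kv] := ltnP v (top k + 4); first by apply: spanned_step; apply: IH.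
  by apply: corners_spanned_all => //; rewrite levelS.
rewrite top0; split.
  move=> v vt vw; have [qs] := covP vt vw.
  case: qs => [|q [|q' [|? ?]]] //=.
    by case/andP=> cq /orP[]/andP[rq _]; [apply: Span01 rq cq | apply: Span32 rq cq].
  case/and3P=> _ cq /orP[]/andP[rq rq']; [exact: Span12_30 rq rq' cq | exact: Span01_23 rq rq' cq].
have H v : t0 <= v < t0 + 4 -> exists2 q, covering 0 v q &
      (route (frame 0) (a 0) (b 0) q && (v \notin [:: a 0; b 0])) ||
       (route (frame 0) (d 0) (c 0) q && (v \notin [:: c 0; d 0])).
  move=> /andP[tv vt]; have vw : v != w by apply: contraTneq tv => ->; rewrite -ltnNge.
  have [qs] := covP vt vw.
  case: qs => [|q [|q' [|? ?]]] //=; first by case/andP=> cq h; exists q.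
  by rewrite ltnNge tv.
split=> v vin; have vt : t0 <= v < t0 + 4 by move: vin; rewrite !inE top0; lia.
  have [q cq /orP[]/andP[rq]] := H v vt; first by rewrite vin.
  by exists q.
have [q cq /orP[]/andP[rq]] := H v vt; last by rewrite vin.
by exists q.
Qed.

Lemma spanned_ham k v : spanned k v ->
  exists2 q, cycle (adj (tower k)) q & covering k v q.
Proof.
have sub : {subset frame k <= tower k} by move=> e h; rewrite /tower mem_cat h.
have [r1 r2] := frame_rung k; have {r1 r2}[r1 r2] := (sub_adj sub r1, sub_adj sub r2).
have [c1 c2] := tower_cap k.
case=> [q /(route_sub sub) rq cq|q /(route_sub sub) rq cq
       |q q' /(route_sub sub) rq /(route_sub sub) rq' cq
       |q q' /(route_sub sub) rq /(route_sub sub) rq' cq].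
- by exists q => //; apply: route_cycle rq; rewrite adjC.
- by exists q => //; apply: route_cycle rq.
- exists (q ++ q') => //; apply: route_cycle (route_cat _ rq rq') => //.
- exists (q ++ q') => //; apply: route_cycle (route_cat _ rq rq') => //; by rewrite adjC.
Qed.

End Family.

(** * Straight-line drawings *)

Section Geometry.

Local Open Scope Z_scope.

Definition orient (p q r : Z * Z) : Z :=
  (q.1 - p.1) * (r.2 - p.2) - (q.2 - p.2) * (r.1 - p.1).

(** Eight integer certificates for [meet_at_ends]: a common end with non-collinear other ends (four
    ways), or one segment strictly on one side of the line through the other (four ways). *)
Definition apart (p q p' q' : Z * Z) : Prop :=
     (p = p' /\ orient p q q' <> 0) \/ (p = q' /\ orient p q p' <> 0)
  \/ (q = p' /\ orient p q q' <> 0) \/ (q = q' /\ orient p q p' <> 0)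
  \/ (0 < orient p q p' /\ 0 < orient p q q')
  \/ (orient p q p' < 0 /\ orient p q q' < 0)
  \/ (0 < orient p' q' p /\ 0 < orient p' q' q)
  \/ (orient p' q' p < 0 /\ orient p' q' q < 0).

Definition same_point (p q : Z * Z) : bool := (p.1 =? q.1) && (p.2 =? q.2).

Definition apartb (p q p' q' : Z * Z) : bool :=
  [|| same_point p p' && ~~ (orient p q q' =? 0),
      same_point p q' && ~~ (orient p q p' =? 0),
      same_point q p' && ~~ (orient p q q' =? 0),
      same_point q q' && ~~ (orient p q p' =? 0),
      (0 <? orient p q p') && (0 <? orient p q q'),
      (orient p q p' <? 0) && (orient p q q' <? 0),
      (0 <? orient p' q' p) && (0 <? orient p' q' q) |
      (orient p' q' p <? 0) && (orient p' q' q <? 0)].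

Lemma same_pointP p q : reflect (p = q) (same_point p q).
Proof.
case: p q => [a b] [c d]; rewrite /same_point /=; apply: (iffP andP) => [[]|[-> ->]].
  by move=> /Z.eqb_eq -> /Z.eqb_eq ->.
by rewrite !Z.eqb_refl.
Qed.

Lemma apartP p q p' q' : apartb p q p' q' -> apart p q p' q'.
Proof.
have ne z : ~~ (z =? 0) -> z <> 0 by move=> /negP h E; apply: h; rewrite E.
have lt x y : x <? y -> x < y by move/Z.ltb_lt.
rewrite /apartb /apart.
by do 4!(case/orP; first by case/andP=> /same_pointP h1 /ne h2; tauto);
   do ?(case/orP; first by case/andP=> /lt h1 /lt h2; tauto);
   case/andP=> /lt h1 /lt h2; tauto.
Qed.

Local Open Scope R_scope.

Definition seg (a b t : R) : R := a + t * (b - a).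

Definition meet_at_ends (p q p' q' : Z * Z) : Prop :=
  forall s t, 0 <= s <= 1 -> 0 <= t <= 1 ->
    seg (IZR p.1) (IZR q.1) s = seg (IZR p'.1) (IZR q'.1) t ->
    seg (IZR p.2) (IZR q.2) s = seg (IZR p'.2) (IZR q'.2) t ->
    (s = 0 \/ s = 1) /\ (t = 0 \/ t = 1).

Lemma meet_sym p q p' q' : meet_at_ends p q p' q' -> meet_at_ends p' q' p q.
Proof. by move=> h s t hs ht ex ey; have [] := h t s ht hs (esym ex) (esym ey). Qed.

Lemma meet_flip p q p' q' : meet_at_ends p q p' q' -> meet_at_ends q p p' q'.
Proof.
move=> h s t hs ht ex ey; have hs1 : 0 <= 1 - s <= 1 by lra.
have rev a b : seg a b (1 - s) = seg b a s by rewrite /seg; ring.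
by have [[] ? ?] := h (1 - s) t hs1 ht (etrans (rev _ _) ex) (etrans (rev _ _) ey);
  split=> //; [right | left]; lra.
Qed.

Lemma IZR_orient p q r : IZR (orient p q r) =
  (IZR q.1 - IZR p.1) * (IZR r.2 - IZR p.2) - (IZR q.2 - IZR p.2) * (IZR r.1 - IZR p.1).
Proof. by rewrite /orient minus_IZR !mult_IZR !minus_IZR. Qed.

(** A common point gives s u = t v for the direction vectors u, v; taking determinants with v and u
    shows that s and t both vanish. *)
Lemma apart_fan p q q' : (orient p q q' <> 0)%Z -> meet_at_ends p q p q'.
Proof.
move=> /eq_IZR_contrapositive; rewrite IZR_orient => o s t hs ht; rewrite /seg => ex ey.
set ux := IZR q.1 - _ in o ex; set uy := IZR q.2 - _ in o ey.
set vx := IZR q'.1 - _ in o ex; set vy := IZR q'.2 - _ in o ey.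
have ex' : s * ux = t * vx by lra.
have ey' : s * uy = t * vy by lra.
have t0 : t * (ux * vy - uy * vx) = 0.
  by transitivity (ux * (t * vy) - uy * (t * vx)); [ring | rewrite -ex' -ey'; ring].
have s0 : s * (ux * vy - uy * vx) = 0.
  by transitivity (s * ux * vy - s * uy * vx); [ring | rewrite ex' ey'; ring].
by case: (Rmult_integral _ _ t0) => // ->; case: (Rmult_integral _ _ s0) => // ->; split; left.
Qed.

(** [orient p q] is affine in its last argument and vanishes on the line; at a common point it would
    also be a convex combination of two numbers of the same strict sign. *)
Lemma apart_sep p q p' q' :
  (0 < orient p q p' /\ 0 < orient p q q' \/ orient p q p' < 0 /\ orient p q q' < 0)%Z ->
  meet_at_ends p q p' q'.
Proof.
move=> H s t hs ht ex ey.
have H' : 0 < IZR (orient p q p') /\ 0 < IZR (orient p q q') \/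
          IZR (orient p q p') < 0 /\ IZR (orient p q q') < 0.
  by case: H => -[h1 h2]; [left | right]; split; apply: IZR_lt.
have E : (1 - t) * IZR (orient p q p') + t * IZR (orient p q q') = 0.
  have ex' : IZR p'.1 + t * (IZR q'.1 - IZR p'.1) = IZR p.1 + s * (IZR q.1 - IZR p.1) by [].
  have ey' : IZR p'.2 + t * (IZR q'.2 - IZR p'.2) = IZR p.2 + s * (IZR q.2 - IZR p.2) by [].
  rewrite !IZR_orient.
  transitivity ((IZR q.1 - IZR p.1) * ((IZR p'.2 + t * (IZR q'.2 - IZR p'.2)) - IZR p.2) -
    (IZR q.2 - IZR p.2) * ((IZR p'.1 + t * (IZR q'.1 - IZR p'.1)) - IZR p.1)); first ring.
  by rewrite ex' ey'; ring.
by exfalso; case: H' => -[h1 h2]; nra.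
Qed.

Lemma orient_rot p q r : orient q p r = (- orient p q r)%Z.
Proof. by rewrite /orient; lia. Qed.

Lemma apart_meet p q p' q' : apart p q p' q' -> meet_at_ends p q p' q'.
Proof.
case=> [[<-]|]; first exact: apart_fan.
case=> [[<- h]|]; first by apply: meet_sym; apply: meet_flip; apply: meet_sym; apply: apart_fan.
case=> [[<- h]|].
  by apply: meet_flip; apply: apart_fan; rewrite orient_rot; lia.
case=> [[<- h]|].
  apply: meet_flip; apply: meet_sym; apply: meet_flip; apply: meet_sym.
  by apply: apart_fan; rewrite orient_rot; lia.
case=> [h|]; first by apply: apart_sep; left.
case=> [h|]; first by apply: apart_sep; right.
by case=> h; apply: meet_sym; apply: apart_sep; [left|right].
Qed.

Lemma left_meet p q p' q' :
  (Z.max p.1 q.1 < Z.min p'.1 q'.1)%Z -> meet_at_ends p q p' q'.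
Proof.
move=> h s t hs ht ex _; exfalso.
have /IZR_lt h0 := h.
have le a b : (a <= b)%Z -> IZR a <= IZR b by apply: IZR_le.
have [/le h1 /le h2] := (Z.le_max_l p.1 q.1, Z.le_max_r p.1 q.1).
have [/le h3 /le h4] := (Z.le_min_l p'.1 q'.1, Z.le_min_r p'.1 q'.1).
have h5 : seg (IZR p.1) (IZR q.1) s <= IZR (Z.max p.1 q.1) by rewrite /seg; nra.
have h6 : IZR (Z.min p'.1 q'.1) <= seg (IZR p'.1) (IZR q'.1) t by rewrite /seg; nra.
lra.
Qed.

Lemma extreme_coord (a b r t e : R) : e = 1 \/ e = -1 ->
  - r <= a <= r -> - r <= b <= r -> 0 < t < 1 -> seg a b t = e * r -> a = b.
Proof. by rewrite /seg; case=> ->; nra. Qed.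

(* A segment inside the square can only contain a corner, an extreme point, as an end. *)
Lemma spoke_meet (r ex ey : Z) p q : (0 < r)%Z -> (ex = 1 \/ ex = -1)%Z -> (ey = 1 \/ ey = -1)%Z ->
  (- r <= p.1 <= r)%Z -> (- r <= p.2 <= r)%Z -> (- r <= q.1 <= r)%Z -> (- r <= q.2 <= r)%Z ->
  p <> q ->
  meet_at_ends (ex * r, ey * r)%Z (ex * (r + 1), ey * (r + 1))%Z p q.
Proof.
move=> r0 hx hy p1 p2 q1 q2 pq s t hs ht /= Ex Ey.
have bd x : (- r <= x <= r)%Z -> - IZR r <= IZR x <= IZR r.
  by move=> [h1 h2]; rewrite -opp_IZR; split; apply: IZR_le.
move/bd: p1 => p1; move/bd: p2 => p2; move/bd: q1 => q1; move/bd: q2 => q2.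
have R0 : 0 < IZR r by apply: IZR_lt.
have un e : (e = 1 \/ e = -1)%Z -> IZR e = 1 \/ IZR e = -1 by case=> ->; [left|right].
move/un: hx => hx; move/un: hy => hy.
move: Ex Ey; rewrite !mult_IZR !plus_IZR => Ex Ey.
have EX : IZR ex * (IZR r + s) = seg (IZR p.1) (IZR q.1) t by rewrite -Ex /seg; ring.
have EY : IZR ey * (IZR r + s) = seg (IZR p.2) (IZR q.2) t by rewrite -Ey /seg; ring.
have s0 : s = 0.
  have : - IZR r <= seg (IZR p.1) (IZR q.1) t <= IZR r by rewrite /seg; nra.
  by rewrite -EX; case: hx => ->; lra.
split; first by left.
have [t0|[t1|t01]] : t = 0 \/ t = 1 \/ 0 < t < 1 by lra.
- by left.
- by right.
case: pq; case: p q {Ex Ey} p1 p2 q1 q2 EX EY => [a b] [c d] /= p1 p2 q1 q2.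
rewrite s0 Rplus_0_r => /esym EX /esym EY.
rewrite (eq_IZR _ _ (extreme_coord hx p1 q1 t01 EX)).
by rewrite (eq_IZR _ _ (extreme_coord hy p2 q2 t01 EY)).
Qed.

Local Open Scope Z_scope.

#[local] Arguments Z.mul : simpl never.
#[local] Arguments Z.add : simpl never.
#[local] Arguments Z.sub : simpl never.

Definition sign_x (i : nat) : Z := match i with 0%N | 3%N => -1 | _ => 1 end.
Definition sign_y (i : nat) : Z := match i with 0%N | 1%N => -1 | _ => 1 end.

Definition corner (r : Z) (i : nat) : Z * Z := (sign_x i * r, sign_y i * r).

Definition box (r : Z) (p : Z * Z) : Prop := (- r <= p.1 <= r) /\ (- r <= p.2 <= r).

Definition rim := [:: (0, 3); (1, 2); (0, 1); (2, 3)]%N.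

(** The line through an outer side has the inner square strictly on one side. Corners are numbered
    counterclockwise, so only the side (0, 3) runs clockwise and gets negative orientations. *)
Lemma rim_box_apart (r : Z) x p q : 0 < r -> x \in rim -> box r p -> box r q ->
  apart (corner (r + 1) x.1) (corner (r + 1) x.2) p q.
Proof.
rewrite !inE => r0 /or4P[]/eqP-> [p1 p2] [q1 q2]; rewrite /apart /orient /=.
- by do 5!right; left; split; nia.
- by do 4!right; left; split; nia.
- by do 4!right; left; split; nia.
- by do 4!right; left; split; nia.
Qed.

Definition spot (r : Z) (i : nat) : Z * Z :=
  if (i < 4)%N then corner r i else corner (r + 1) (i - 4).

Definition collar := spokes ++ map (shift 4) rim.

Definition same_edge (e e' : nat * nat) : bool :=
  (e == e') || (e.1 == e'.2) && (e.2 == e'.1).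

Ltac apart_solve := rewrite /apart /orient /=;
  first [ by left; split; [reflexivity | nia]
        | by right; left; split; [reflexivity | nia]
        | by do 2!right; left; split; [reflexivity | nia]
        | by do 3!right; left; split; [reflexivity | nia]
        | by do 4!right; left; split; nia
        | by do 5!right; left; split; nia
        | by do 6!right; left; split; nia
        | by do 7!right; split; nia ].

Lemma ring_meet (r : Z) x y : 0 < r -> x \in collar -> y \in collar -> ~~ same_edge x y ->
  meet_at_ends (spot r x.1) (spot r x.2) (spot r y.1) (spot r y.2).
Proof.
move=> r0 xr yr.
have mem8 (P : nat * nat -> Prop) : P (0, 4)%N -> P (1, 5)%N -> P (2, 6)%N -> P (3, 7)%N ->
    P (4, 7)%N -> P (5, 6)%N -> P (4, 5)%N -> P (6, 7)%N -> forall z, z \in collar -> P z.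
  move=> h1 h2 h3 h4 h5 h6 h7 h8 z; rewrite !inE.
  by do 7!(case/orP; first by move/eqP->); move/eqP->.
move: x xr; apply: (mem8); move: y yr; apply: (mem8); (try by []); move=> _;
  rewrite /spot /corner /=.
all: first [ by apply: left_meet => /=; lia | by apply: meet_sym; apply: left_meet => /=; lia
           | by apply: apart_meet; apart_solve ].
Qed.

(** * Drawing the tower on concentric squares *)

Section Drawing.

Variables (t0 w : nat) (E0 : seq (nat * nat)) (r : Z) (place : seq (Z * Z)).
Local Notation top := (level t0).
Local Notation tower := (tower t0 E0).

Definition pos (x : nat) : Z * Z :=
  if (x < t0)%N then nth (0, 0) place x
  else corner (r + Z.of_nat ((x - t0) %/ 4)) ((x - t0) %% 4).

Hypothesis r0 : 0 < r.
Hypothesis place_in : forall x, (x < t0)%N -> - r < (pos x).1 < r /\ - r < (pos x).2 < r.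
Hypothesis place_inj : forall x y, (x < t0)%N -> (y < t0)%N -> pos x = pos y -> x = y.

Lemma pos_top k i : (i < 4)%N -> pos (top k + i) = corner (r + Z.of_nat k) i.
Proof.
move=> i4; rewrite /pos /level -addnA ltnNge leq_addr /= addKn.
by rewrite mulnC divnMDl // modnMDl divn_small // modn_small // addn0.
Qed.

Lemma top_split x : (t0 <= x)%N -> exists k i, (i < 4)%N /\ x = (top k + i)%N.
Proof.
move=> tx; exists ((x - t0) %/ 4)%N, ((x - t0) %% 4)%N; split; first by rewrite ltn_mod.
by rewrite /level -addnA mulnC -divn_eq subnKC.
Qed.

Lemma corner_abs R i : 0 <= R -> Z.abs (corner R i).1 = R.
Proof. by move=> R0; case: i => [|[|[|[|i]]]]; rewrite /corner /=; lia. Qed.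

Lemma pos_box k x : (x < top k + 4)%N -> box (r + Z.of_nat k) (pos x).
Proof.
have [xt _|tx] := ltnP x t0.
  by have [h1 h2] := place_in xt; rewrite /box; lia.
have [j [i [i4 ->]]] := top_split tx => xk.
have jk : Z.of_nat j <= Z.of_nat k by move: xk; rewrite /level; lia.
rewrite pos_top // /box; case: i i4 {xk} => [|[|[|[|i]]]] //= _; lia.
Qed.

Lemma pos_inj x y : pos x = pos y -> x = y.
Proof.
wlog xy : x y / (x <= y)%N.
  by move=> H; case: (leqP x y) => [/H //|/ltnW/H h /esym/h].
have [yt|ty] := ltnP y t0; first by apply: place_inj => //; apply: leq_ltn_trans yt.
have [j [i [i4 ->]]] := top_split ty; rewrite pos_top //.
have [xt E|tx] := ltnP x t0.
  have [h _] := place_in xt.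
  have pj : 0 <= r + Z.of_nat j by lia.
  by have := corner_abs i pj; rewrite -E; lia.
have [j' [i' [i4' ->]]] := top_split tx; rewrite pos_top // => E.
(* The absolute value of the first coordinate of a corner is the half-side of its square, hence
   determines the stage. *)
have Ej : j' = j.
  have pj (m : nat) : 0 <= r + Z.of_nat m by lia.
  by have := corner_abs i' (pj j'); have := corner_abs i (pj j); rewrite E; lia.
subst j'; congr addn; case: E {tx ty} => E1 E2.
by case: i i4 E1 E2 => [|[|[|[|i]]]] //; case: i' i4' => [|[|[|[|i']]]] //= *; lia.
Qed.

Hypothesis E0P : all (fun e => [&& e.1 < t0, e.2 < t0 + 4 & (e.2 == t0) ==> (e.1 == w)])%N E0.
Hypothesis E0d : distinct E0.
Hypothesis base_meet : forall e e', e \in tower 0 -> e' \in tower 0 -> ~~ same_edge e e' ->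
  apartb (pos e.1) (pos e.2) (pos e'.1) (pos e'.2).

Lemma tower_bound k (e : nat * nat) : e \in tower k -> (e.1 < top k + 4)%N /\ (e.2 < top k + 4)%N.
Proof.
rewrite /tower /frame -catA mem_cat => /orP[/(skel_bound E0P)[h1 h2]|].
  by split=> //; apply: ltn_addr.
by rewrite /= !inE => /or4P[]/eqP-> /=; rewrite !ltn_add2l.
Qed.

Lemma tower_irr k e : e \in tower k -> e.1 != e.2.
Proof.
have irr L : distinct L -> e \in L -> e.1 != e.2.
  by elim: L => //= f L IH /and3P[h1 _ /IH h2]; rewrite inE => /predU1P[->|].
have sh t L : all (fun f => f.1 != f.2) L -> e \in map (shift t) L -> e.1 != e.2.
  by move=> /allP h /mapP[f /h fL ->]; rewrite /= eqn_add2l.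
have sk : e \in skel t0 E0 k -> e.1 != e.2.
  by elim: k => [|k IH]; [apply: irr | rewrite mem_cat => /orP[/IH|/sh]//; apply].
by rewrite /tower /frame -catA !mem_cat => /or3P[/sk|/sh|/sh] //; apply.
Qed.

(** An inclusion suffices: the deleted caps of stage [k] may stay in the drawing, where all the
    nested squares appear complete. *)
Lemma tower_step k e : e \in tower k.+1 ->
  e \in tower k \/ exists2 x, x \in collar & e = shift (top k) x.
Proof.
rewrite /tower /frame.
rewrite skelS.
have sh x y : shift (top k.+1) (x, y) = shift (top k) (4 + x, 4 + y)%N.
  by rewrite /shift /= levelS !addnA.
rewrite !mem_cat => /orP[/orP[/or3P[->|->|/mapP[x xs ->]]|H]|H].
- by left.
- by left; rewrite orbT.
- by right; exists x => //; rewrite mem_cat xs.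
- by right; move: H; rewrite /= !inE !sh => /orP[]/eqP->; [exists (4, 7)%N | exists (5, 6)%N].
- by right; move: H; rewrite /= !inE !sh => /orP[]/eqP->; [exists (4, 5)%N | exists (6, 7)%N].
Qed.

Lemma pos_spot k i : (i < 8)%N -> pos (top k + i) = spot (r + Z.of_nat k) i.
Proof.
rewrite /spot; case: (ltnP i 4) => [i4 _|i4 i8]; first exact: pos_top.
rewrite -[in LHS](subnKC i4) addnA -levelS pos_top; last by rewrite ltn_subLR.
by congr corner; lia.
Qed.

(** Old edges lie in the old square. A new outer side avoids that square, a spoke meets it in a
    corner only, and two new edges are compared by [ring_meet]. *)
Lemma tower_meet k e e' : e \in tower k -> e' \in tower k -> ~~ same_edge e e' ->
  meet_at_ends (pos e.1) (pos e.2) (pos e'.1) (pos e'.2).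
Proof.
elim: k e e' => [|k IH] e e'.
  by move=> h h' ne; apply: apart_meet; apply: apartP; apply: base_meet.
have rk : 0 < r + Z.of_nat k by lia.
have r8 x : x \in collar -> (x.1 < 8)%N /\ (x.2 < 8)%N.
  by have /allP h : all (fun x => (x.1 < 8) && (x.2 < 8))%N collar by []; move=> /h/andP.
have mixed x f : x \in collar -> f \in tower k ->
    meet_at_ends (pos (top k + x.1)) (pos (top k + x.2)) (pos f.1) (pos f.2).
  move=> xr fk; have [x1 x2] := r8 x xr; rewrite !pos_spot //.
  have [f1 f2] := tower_bound fk; have [b1 b2] := (pos_box f1, pos_box f2).
  move: xr; rewrite mem_cat => /orP[|/mapP[y yr ->]]; last first.
    have [] : (y.1 < 4)%N /\ (y.2 < 4)%N.
      by have /allP h : all (fun x => (x.1 < 4) && (x.2 < 4))%N rim by []; apply/andP/h.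
    move=> y1 y2; rewrite /spot /= !addKn.
    by apply: apart_meet; apply: rim_box_apart.
  have ne : pos f.1 <> pos f.2 by move/pos_inj/eqP; apply/negP; apply: tower_irr fk.
  case: b1 b2 => [b1 b1'] [b2 b2'].
  by rewrite !inE => /or4P[]/eqP->; rewrite /spot /corner /=; apply: spoke_meet => //; auto.
move=> /tower_step[ek|[x xr ->]] /tower_step[ek'|[y yr ->]] ne.
- exact: IH.
- by apply: meet_sym; apply: mixed.
- exact: mixed.
have [x1 x2] := r8 x xr; have [y1 y2] := r8 y yr.
rewrite /= !pos_spot //; apply: ring_meet => //.
apply: contraNN ne; rewrite /same_edge /= !eqn_add2l => /orP[/eqP->|->]; rewrite ?eqxx ?orbT //.
Qed.

End Drawing.

Local Open Scope R_scope.

(** The third hypothesis, a neighbour for every vertex, reduces the requirement that arcs avoid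
    foreign vertices to the one on pairs of edges. *)
Lemma straight_planar n (L : seq (nat * nat)) (p : nat -> Z * Z) :
  (forall x y, p x = p y -> x = y) ->
  (forall x y, adj L x y -> x <> y) ->
  (forall x, (x < n)%N -> exists y, (y < n)%N /\ adj L x y) ->
  (forall e e', e \in L -> e' \in L -> ~~ same_edge e e' ->
     meet_at_ends (p e.1) (p e.2) (p e'.1) (p e'.2)) ->
  planar (fun x y : 'I_n => adj L x y).
Proof.
move=> pinj irr deg1 meet.
have meetA u v u' v' : adj L u v -> adj L u' v' -> ~ (u = u' /\ v = v') -> ~ (u = v' /\ v = u') ->
    meet_at_ends (p u) (p v) (p u') (p v').
  have ne a b c d : ~ (a = c /\ b = d) -> ~ (a = d /\ b = c) -> ~~ same_edge (a, b) (c, d).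
    move=> h1 h2; apply/negP => /orP[/eqP[? ?]|/andP[/eqP/= ? /eqP/= ?]]; first exact: h1.
    exact: h2.
  move=> /orP[] e1 /orP[] e2 n1 n2.
  - by have := meet _ _ e1 e2 (ne _ _ _ _ n1 n2).
  - apply: meet_sym; apply: meet_flip; apply: meet_sym.
    by apply: (meet _ _ e1 e2); apply: ne => -[h1 h2]; [apply: n2 | apply: n1].
  - by apply: meet_flip; apply: (meet _ _ e1 e2); apply: ne => -[h1 h2]; [apply: n2 | apply: n1].
  - apply: meet_flip; apply: meet_sym; apply: meet_flip; apply: meet_sym.
    by apply: (meet _ _ e1 e2); apply: ne => -[h1 h2]; [apply: n1 | apply: n2].
have inj u v : IZR (p u).1 = IZR (p v).1 -> IZR (p u).2 = IZR (p v).2 -> u = v.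
  move=> /eq_IZR h1 /eq_IZR h2; apply: pinj.
  by rewrite (surjective_pairing (p u)) (surjective_pairing (p v)) h1 h2.
have seg0 a b : seg a b 0 = a by rewrite /seg; ring.
have seg1 a b : seg a b 1 = b by rewrite /seg; ring.
have seg_inj u v s t : u <> v ->
    seg (IZR (p u).1) (IZR (p v).1) s = seg (IZR (p u).1) (IZR (p v).1) t ->
    seg (IZR (p u).2) (IZR (p v).2) s = seg (IZR (p u).2) (IZR (p v).2) t -> s = t.
  rewrite /seg => uv h1 h2.
  have E1 : (s - t) * (IZR (p v).1 - IZR (p u).1) = 0 by lra.
  have E2 : (s - t) * (IZR (p v).2 - IZR (p u).2) = 0 by lra.
  case: (Rmult_integral _ _ E1) => [|F1]; first lra.
  case: (Rmult_integral _ _ E2) => [|F2]; first lra.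
  by case: uv; apply: inj; lra.
exists (fun x : 'I_n => IZR (p x).1), (fun x : 'I_n => IZR (p x).2).
exists (fun u v : 'I_n => seg (IZR (p u).1) (IZR (p v).1)).
exists (fun u v : 'I_n => seg (IZR (p u).2) (IZR (p v).2)).
split.
- by move=> u v h1 h2; apply: val_inj; apply: inj.
- move=> u v uv; split.
  + by split=> t; rewrite /seg; reg.
  + by rewrite !seg0.
  + by rewrite !seg1.
  + by move=> s t _ _; apply: seg_inj; apply: irr.
  move=> t x t01 [h1 h2].
  have [y [yn xy]] := deg1 x (ltn_ord x).
  have [E|/eqP nxu] := eqVneq (x : nat) u.
    have t0 : t = 0; last lra.
    by apply: (@seg_inj u v) => //; [apply: irr | rewrite seg0 h1 E | rewrite seg0 h2 E].
  have [E|/eqP nxv] := eqVneq (x : nat) v.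
    have t1 : t = 1; last lra.
    by apply: (@seg_inj u v) => //; [apply: irr | rewrite seg1 h1 E | rewrite seg1 h2 E].
  (* An arc through the vertex [x] meets the edge from [x] to [y] at its parameter 0, so [t] would
     have to be 0 or 1. *)
  have H := meetA u v x y uv xy.
  have [||||||[] ] := H _ _ t 0.
  all: try lra.
  + by case=> E _; apply: nxu.
  + by case=> _ E; apply: nxv.
  + by rewrite seg0.
  + by rewrite seg0.
- move=> u v u' v' uv uv' n1 n2 s t hs ht; apply: (meetA u v u' v') => //.
  + by case=> h1 h2; apply: n1; split; apply: val_inj.
  + by case=> h1 h2; apply: n2; split; apply: val_inj.
Qed.

End Geometry.

(** * Base graphs *)

(* The vertices are [0, ..., core + 3], the last four being the corners of the quadrilateral, and
   [hub] is the exceptional vertex.  The order of [inner], which omits the sides of the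
   quadrilateral, is the one in which [run] keeps few states.  For each [v != hub], [covers]
   gives the routes of [spanned 0 v]. *)
Record base := {
  core : nat;
  hub : nat;
  radius : Z;
  inner : seq (nat * nat);
  place : seq (Z * Z);
  covers : seq (nat * seq (seq nat))
}.

Section Base.

Variable g : base.
Local Notation t0 := (core g).
Local Notation w := (hub g).
Local Notation E0 := (inner g).
Local Notation top := (level t0).
Local Notation tower := (tower t0 E0).
Local Notation point := (pos t0 (radius g) (place g)).

Definition edges_ok : bool :=
  [&& w < t0, distinct E0,
      all (fun e => [&& e.1 < t0, e.2 < t0 + 4 & (e.2 == t0) ==> (e.1 == w)]) E0 &
      count (adj E0 w) (iota 0 (t0 + 4)) == 3].

Definition run_ok : bool :=
  all (fun st => all (fun p => t0 <= p.1) st && (lower t0 st \in corner_states))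
      (run [:: t0; t0 + 1; t0 + 2; t0 + 3] E0 [:: isolated (iota 0 (t0 + 4))]).

Definition run_minus_ok : bool :=
  nilp (run [:: t0; t0 + 1; t0 + 2; t0 + 3] [seq e <- E0 | (e.1 != w) && (e.2 != w)]
            [:: isolated [seq x <- iota 0 (t0 + 4) | x != w]]).

Definition covers_ok : bool :=
  all (fun v => v \in w :: unzip1 (covers g)) (iota 0 (t0 + 4)) &&
  all (fun e => spanned_by t0 E0 e.1 e.2) (covers g).

Definition drawing_ok : bool :=
  [&& (0 <? radius g)%Z,
      all (fun x => [&& - radius g <? (point x).1, (point x).1 <? radius g,
                        - radius g <? (point x).2 & (point x).2 <? radius g]%Z) (iota 0 t0),
      allrel (fun x y => same_point (point x) (point y) ==> (x == y)) (iota 0 t0) (iota 0 t0) &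
      allrel (fun e e' => same_edge e e' ||
                apartb (point e.1) (point e.2) (point e'.1) (point e'.2)) (tower 0) (tower 0)].

Hypothesis eok : edges_ok.
Hypothesis rok : run_ok.
Hypothesis rmok : run_minus_ok.
Hypothesis cok : covers_ok.
Hypothesis dok : drawing_ok.

Let wt : w < t0. Proof. by case/and4P: eok. Qed.
Let E0d : distinct E0. Proof. by case/and4P: eok. Qed.
Let E0P : all (fun e => [&& e.1 < t0, e.2 < t0 + 4 & (e.2 == t0) ==> (e.1 == w)]) E0.
Proof. by case/and4P: eok. Qed.

Lemma tower_minus_cycle k v : v < top k + 4 -> v != w ->
  exists2 q, cycle (adj (tower k)) q & perm_eq (v :: q) (iota 0 (top k + 4)).
Proof.
move=> vt vw; apply: spanned_ham; apply: (@spanned_all t0 w E0) => // u ut uw.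
have [/allP all_v /allP all_q] := andP cok.
have := all_v u; rewrite mem_iota inE (negPf uw) => /(_ ut) /mapP[e /all_q eP ->].
by exists e.2.
Qed.

Lemma avoid3 (x y z : nat) : exists2 v, v < 4 & v \notin [:: x; y; z].
Proof.
suff /hasP[v] : has (fun v => v \notin [:: x; y; z]) (iota 0 4).
  by rewrite mem_iota; exists v.
rewrite -[has _ _]negbK -all_predC; apply/negP => /allP h.
have := @uniq_leq_size _ (iota 0 4) [:: x; y; z] (iota_uniq 0 4).
by case/(_ _)/implyP => // v /h /=; rewrite negbK.
Qed.

(** Some [v] other than [x] and the hub can be deleted, and then [x] lies on a hamiltonian cycle of
    the rest. *)
Lemma tower_neighbour k x : x < top k + 4 -> exists y, y < top k + 4 /\ adj (tower k) x y.
Proof.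
move=> xt; have [v v4] := avoid3 x x w; rewrite !inE !negb_or => /and3P[vx _ vw].
have vt : v < top k + 4 by apply: leq_trans v4 _; apply: leq_addl.
have [q cq pq] := tower_minus_cycle vt vw.
have xq : x \in q.
  have : x \in v :: q by rewrite (perm_mem pq) mem_iota.
  by rewrite inE eq_sym (negPf vx).
exists (next q x); split; last exact: next_cycle.
have : next q x \in iota 0 (top k + 4) by rewrite -(perm_mem pq) inE mem_next xq orbT.
by rewrite mem_iota.
Qed.

Lemma tower_irrefl k x y : adj (tower k) x y -> x <> y.
Proof. by move=> /orP[] /(tower_irr E0d) /eqP /= h E; apply: h. Qed.

Section Level.

Variable k : nat.
Local Notation n := (top k + 4).

Definition graph : rel 'I_n := fun x y => adj (tower k) x y.

Lemma graph_simple : simple_graph graph.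
Proof.
by split=> [x y|x]; [exact: adjC | apply/negP => /tower_irrefl].
Qed.

Lemma graph_planar : planar graph.
Proof.
have [/Z.ltb_lt r0 /allP inb /allrelP inj /allrelP mt] := and4P dok.
apply: (straight_planar (p := point)).
- apply: (pos_inj r0) => [x xt|x y xt yt E].
    have := inb x; rewrite mem_iota /= => /(_ xt) /and4P[].
    by move=> /Z.ltb_lt h1 /Z.ltb_lt h2 /Z.ltb_lt h3 /Z.ltb_lt h4.
  have := inj x y; rewrite !mem_iota /= => /(_ xt yt) /implyP h.
  by apply/eqP; apply: h; apply/same_pointP.
- exact: tower_irrefl.
- exact: tower_neighbour.
apply: (tower_meet (w := w)) => //.
- move=> x xt; have := inb x; rewrite mem_iota /= => /(_ xt) /and4P[].
  by move=> /Z.ltb_lt h1 /Z.ltb_lt h2 /Z.ltb_lt h3 /Z.ltb_lt h4.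
- move=> x y xt yt E; have := inj x y; rewrite !mem_iota /= => /(_ xt yt) /implyP h.
  by apply/eqP; apply: h; apply/same_pointP.
- by move=> e e' he he' ne; have := mt e e' he he'; rewrite (negPf ne).
Qed.

Lemma hamiltonian_onP (S : {set 'I_n}) : hamiltonian_on graph S ->
  exists s : seq nat, [/\ uniq s, 2 < size s, cycle (adj (tower k)) s &
    forall x : 'I_n, (val x \in s) = (x \in S)].
Proof.
case=> s [us sS ss cs]; exists (map val s); split.
- by rewrite map_inj_uniq //; exact: val_inj.
- by rewrite size_map.
- by rewrite cycle_map.
- by move=> x; rewrite mem_map ?sS //; exact: val_inj.
Qed.

Lemma graph_nonham : ~ hamiltonian graph.
Proof.
case/hamiltonian_onP=> s [us ss cs sP].
have sin x : x < n -> x \in s by move=> xn; have := sP (Ordinal xn); rewrite /= inE => ->.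
apply: (tower_nonham E0P E0d us ss cs _ rok) => [x _|x xt]; first exact: sin.
by apply: sin; apply: leq_trans xt _; rewrite leq_add2r leq_addr.
Qed.

Lemma hub_lt : w < n.
Proof. by apply: leq_trans wt _; rewrite /level -addnA leq_addr. Qed.

Lemma graph_minus_nonham : ~ hamiltonian_minus graph (Ordinal hub_lt).
Proof.
case/hamiltonian_onP=> s [us ss cs sP].
have sin x : x < n -> x != w -> x \in s.
  by move=> xn xw; have := sP (Ordinal xn); rewrite /= !inE -val_eqE /= xw.
apply: (tower_minus_nonham E0P E0d us ss cs).
- move=> x tx xn; apply: sin => //; apply: contraTneq tx => ->; by rewrite -ltnNge.
- by have := sP (Ordinal hub_lt); rewrite /= !inE eqxx => ->.
- by move=> x xt; apply: sin; apply: leq_trans xt _; rewrite leq_add2r leq_addr.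
- exact/nilP.
Qed.

Lemma graph_minus_ham (v : 'I_n) : v != Ordinal hub_lt -> hamiltonian_minus graph v.
Proof.
rewrite -val_eqE /= => vw; have [q cq pq] := tower_minus_cycle (ltn_ord v) vw.
have /andP[vq uq] : uniq (val v :: q) by rewrite (perm_uniq pq) iota_uniq.
have qn : all (fun x => x < n) q.
  by apply/allP => x xq; have := perm_mem pq x; rewrite inE xq orbT mem_iota.
(* All entries are below [n], so the passage to ordinals loses none. *)
have E : map val (pmap (insub : nat -> option 'I_n) q) = q.
  by rewrite (pmap_filter (insubK _)) (eq_in_filter (a2 := predT)) ?filter_predT //
     => x /(allP qn) xn /=; rewrite insubT.
exists (pmap insub q); split.
- by rewrite -(map_inj_uniq val_inj) E.
- move=> x; rewrite -(mem_map val_inj) E !inE -val_eqE.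
  have := perm_mem pq (val x); rewrite mem_iota /= add0n ltn_ord inE.
  by case: eqP => [-> _|_ /= ->] //; rewrite (negPf vq).
- rewrite -(size_map val) E; have := perm_size pq; rewrite /= size_iota => En.
  by rewrite -ltnS En addn4.
- by rewrite -E cycle_map in cq.
Qed.

(** Any two vertices lie on a common cycle, a hamiltonian one of the graph without some third vertex
    other than the hub. *)
Lemma graph_connected : connected_graph graph.
Proof.
move=> x y; have [v v4] := avoid3 x y w; rewrite !inE !negb_or => /and3P[vx vy vw].
have vn : v < n by apply: leq_trans v4 _; apply: leq_addl.
have [|s [us sP _ cs]] := @graph_minus_ham (Ordinal vn); first by rewrite -val_eqE.
by apply: (connect_cycle cs); rewrite sP !inE -val_eqE /= eq_sym.
Qed.

(** The hub lies below [t0], so the later stages add no edge at it and the count made in [edges_ok]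
    remains valid. *)
Lemma graph_degree : degree graph (Ordinal hub_lt) = 3.
Proof.
have low y : adj (tower k) w y = adj E0 w y.
  have top0 : top 0 = t0 by rewrite /level muln0 addn0.
  apply/idP/idP.
    by case/orP=> /(tower_split (leq0n k)) [h|[/= h1 h2]]; rewrite /adj ?h ?orbT //;
       move: wt h1 h2; rewrite top0 ltnNge => /negbTE->.
  by apply: sub_adj => e he; rewrite /tower /frame !mem_cat (@skel_mono _ _ 0 k).
rewrite /degree cardsE cardE -(size_map val) /graph.
have -> : map val (enum (fun u : 'I_n => adj (tower k) (Ordinal hub_lt) u)) =
          filter (adj E0 w) (iota 0 n).
  rewrite -val_enum_ord filter_map enumT; congr map; apply: eq_filter => u /=.
  by rewrite unfold_in low.
rewrite size_filter -[n]/(t0 + 4 * k + 4) addnAC iotaD count_cat.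
have /and4P[_ _ _ /eqP->] := eok.
rewrite (eq_in_count (a2 := pred0)) ?count_pred0 // => x; rewrite mem_iota add0n => /andP[xt _].
apply/negP => /orP[] /(allP E0P) /= /and3P[h1 h2 _]; move: wt; lia.
Qed.

End Level.
End Base.

Definition base_ok (g : base) : bool :=
  [&& edges_ok g, run_ok g, run_minus_ok g, covers_ok g & drawing_ok g].

Lemma base_family (g : base) (k n : nat) : base_ok g -> n = core g + 4 + 4 * k ->
  exists (e : rel 'I_n) (w : 'I_n),
    [/\ simple_graph e, connected_graph e, planar e,
        almost_hypohamiltonian_with e w & degree e w = 3].
Proof.
case/and5P=> eok rok rmok cok dok; rewrite addnAC -[core g + _]/(level (core g) k) => ->.
exists (@graph g k), (Ordinal (hub_lt eok k)); split.
- exact: graph_simple.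
- exact: graph_connected.
- exact: graph_planar.
- split; [exact: graph_nonham | exact: graph_minus_nonham | exact: graph_minus_ham].
- exact: graph_degree.
Qed.

(** * Data of the four base graphs, their verification, and the theorem *)

Definition base36 : base := {|
  core := 32;
  hub := 27;
  radius := 100%Z;
  inner := [::
    (0, 4); (0, 1); (0, 2); (1, 8); (1, 34); (2, 3); (2, 35); (3, 13); (3, 5);
    (4, 5); (4, 6); (5, 11); (6, 7); (6, 8); (7, 11); (7, 10); (8, 9); (9, 14);
    (9, 10); (10, 15); (11, 12); (11, 17); (12, 21); (12, 13); (13, 18); (14, 16);
    (14, 34); (15, 16); (15, 17); (15, 22); (16, 23); (17, 20); (18, 19); (18, 35);
    (19, 27); (19, 21); (20, 21); (20, 24); (21, 28); (22, 25); (22, 24); (23, 25);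
    (23, 33); (24, 26); (25, 30); (26, 28); (26, 30); (27, 29); (27, 32); (28, 29);
    (29, 31); (30, 31); (31, 33)];
  place := [::
    (7, 68); (49, 75); (-39, 74); (-23, 54); (10, 55); (-2, 47); (25, 50);
    (23, 38); (41, 57); (49, 47); (37, 32); (8, 31); (-9, 25); (-29, 42); (69, 51);
    (38, 11); (59, 7); (20, 15); (-54, 48); (-34, 1); (13, 2); (-6, 1); (38, -9);
    (69, -41); (25, -10); (49, -29); (24, -23); (-43, -48); (8, -22); (4, -43);
    (41, -37); (48, -60)]%Z;
  covers := [::
    (0, [:: [:: 32; 27; 19; 18; 35; 2; 3; 13; 12; 21; 28; 29; 31; 30; 26; 24; 20;
    17; 11; 5; 4; 6; 7; 10; 15; 22; 25; 23; 16; 14; 9; 8; 1; 34; 33]]);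
    (1, [:: [:: 32; 27; 19; 18; 35; 2; 0; 4; 5; 3; 13; 12; 21; 28; 29; 31; 30; 26;
    24; 20; 17; 11; 7; 6; 8; 9; 10; 15; 22; 25; 23; 16; 14; 34; 33]]);
    (2, [:: [:: 32; 35; 18; 19; 27; 29; 31; 30; 26; 28; 21; 12; 13; 3; 5; 11; 17;
    20; 24; 22; 25; 23; 16; 15; 10; 7; 6; 4; 0; 1; 8; 9; 14; 34; 33]]);
    (3, [:: [:: 33; 31; 29; 28; 26; 30; 25; 23; 16; 14; 34]; [:: 35; 2; 0; 1; 8; 9;
    10; 7; 6; 4; 5; 11; 17; 15; 22; 24; 20; 21; 12; 13; 18; 19; 27; 32]]);
    (4, [:: [:: 35; 32; 27; 29; 31; 33; 23; 16; 15; 17; 20; 24; 22; 25; 30; 26; 28;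
    21; 19; 18; 13; 12; 11; 5; 3; 2; 0; 1; 8; 6; 7; 10; 9; 14; 34]]);
    (5, [:: [:: 32; 27; 19; 18; 35; 2; 3; 13; 12; 21; 28; 29; 31; 30; 26; 24; 20;
    17; 11; 7; 10; 15; 22; 25; 23; 16; 14; 9; 8; 6; 4; 0; 1; 34; 33]]);
    (6, [:: [:: 32; 27; 19; 18; 35; 2; 0; 4; 5; 3; 13; 12; 21; 28; 29; 31; 30; 26;
    24; 20; 17; 11; 7; 10; 15; 22; 25; 23; 16; 14; 9; 8; 1; 34; 33]]);
    (7, [:: [:: 32; 27; 19; 18; 35; 2; 0; 1; 8; 6; 4; 5; 3; 13; 12; 11; 17; 20; 21;
    28; 29; 31; 30; 26; 24; 22; 25; 23; 16; 15; 10; 9; 14; 34; 33]]);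
    (8, [:: [:: 35; 32; 27; 29; 28; 26; 24; 20; 17; 15; 22; 25; 30; 31; 33; 23; 16;
    14; 9; 10; 7; 6; 4; 5; 11; 12; 21; 19; 18; 13; 3; 2; 0; 1; 34]]);
    (9, [:: [:: 32; 27; 19; 18; 35; 2; 3; 13; 12; 21; 28; 29; 31; 30; 26; 24; 20;
    17; 11; 5; 4; 0; 1; 8; 6; 7; 10; 15; 22; 25; 23; 16; 14; 34; 33]]);
    (10, [:: [:: 32; 27; 19; 18; 35; 2; 3; 13; 12; 21; 28; 29; 31; 30; 26; 24; 20;
    17; 15; 22; 25; 23; 16; 14; 9; 8; 6; 7; 11; 5; 4; 0; 1; 34; 33]]);
    (11, [:: [:: 32; 27; 19; 18; 35; 2; 0; 4; 5; 3; 13; 12; 21; 28; 29; 31; 30; 26;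
    24; 20; 17; 15; 22; 25; 23; 16; 14; 9; 10; 7; 6; 8; 1; 34; 33]]);
    (12, [:: [:: 32; 27; 19; 21; 28; 29; 31; 30; 26; 24; 20; 17; 11; 7; 10; 15; 22;
    25; 23; 16; 14; 9; 8; 6; 4; 5; 3; 13; 18; 35; 2; 0; 1; 34; 33]]);
    (13, [:: [:: 32; 35; 18; 19; 27; 29; 31; 30; 26; 28; 21; 12; 11; 17; 20; 24;
    22; 25; 23; 16; 15; 10; 7; 6; 4; 5; 3; 2; 0; 1; 8; 9; 14; 34; 33]]);
    (14, [:: [:: 35; 32; 27; 29; 31; 33; 23; 16; 15; 17; 20; 24; 22; 25; 30; 26;
    28; 21; 19; 18; 13; 12; 11; 5; 3; 2; 0; 4; 6; 7; 10; 9; 8; 1; 34]]);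
    (15, [:: [:: 32; 27; 19; 18; 35; 2; 0; 4; 5; 3; 13; 12; 11; 17; 20; 21; 28; 29;
    31; 30; 26; 24; 22; 25; 23; 16; 14; 9; 10; 7; 6; 8; 1; 34; 33]]);
    (16, [:: [:: 32; 27; 19; 18; 35; 2; 3; 13; 12; 21; 28; 29; 31; 30; 26; 24; 20;
    17; 11; 5; 4; 0; 1; 34; 14; 9; 8; 6; 7; 10; 15; 22; 25; 23; 33]]);
    (17, [:: [:: 32; 27; 19; 18; 35; 2; 3; 13; 12; 21; 20; 24; 26; 28; 29; 31; 30;
    25; 22; 15; 10; 9; 8; 6; 7; 11; 5; 4; 0; 1; 34; 14; 16; 23; 33]]);
    (18, [:: [:: 33; 31; 29; 28; 26; 30; 25; 23; 16; 14; 34]; [:: 35; 2; 0; 1; 8;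
    9; 10; 15; 22; 24; 20; 17; 11; 7; 6; 4; 5; 3; 13; 12; 21; 19; 27; 32]]);
    (19, [:: [:: 32; 27; 29; 31; 30; 26; 28; 21; 12; 13; 18; 35; 2; 3; 5; 11; 17;
    20; 24; 22; 25; 23; 16; 15; 10; 7; 6; 4; 0; 1; 8; 9; 14; 34; 33]]);
    (20, [:: [:: 32; 27; 19; 18; 35; 2; 3; 13; 12; 21; 28; 29; 31; 30; 26; 24; 22;
    25; 23; 16; 14; 9; 8; 6; 7; 10; 15; 17; 11; 5; 4; 0; 1; 34; 33]]);
    (21, [:: [:: 32; 35; 2; 3; 5; 4; 0; 1; 34; 14; 16; 23; 25; 22; 24; 20; 17; 15;
    10; 9; 8; 6; 7; 11; 12; 13; 18; 19; 27; 29; 28; 26; 30; 31; 33]]);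
    (22, [:: [:: 32; 27; 19; 18; 35; 2; 3; 13; 12; 21; 20; 24; 26; 28; 29; 31; 30;
    25; 23; 16; 14; 9; 8; 6; 7; 10; 15; 17; 11; 5; 4; 0; 1; 34; 33]]);
    (23, [:: [:: 32; 27; 19; 18; 35; 2; 0; 4; 6; 7; 10; 9; 8; 1; 34; 14; 16; 15;
    17; 11; 5; 3; 13; 12; 21; 20; 24; 22; 25; 30; 26; 28; 29; 31; 33]]);
    (24, [:: [:: 32; 35; 18; 13; 12; 11; 7; 10; 9; 8; 6; 4; 5; 3; 2; 0; 1; 34; 14;
    16; 23; 25; 22; 15; 17; 20; 21; 19; 27; 29; 28; 26; 30; 31; 33]]);
    (25, [:: [:: 35; 32; 27; 19; 18; 13; 12; 11; 17; 20; 21; 28; 29; 31; 30; 26;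
    24; 22; 15; 10; 7; 6; 4; 5; 3; 2; 0; 1; 8; 9; 14; 16; 23; 33; 34]]);
    (26, [:: [:: 32; 27; 19; 18; 35; 2; 3; 13; 12; 21; 28; 29; 31; 30; 25; 23; 16;
    14; 9; 8; 6; 7; 10; 15; 22; 24; 20; 17; 11; 5; 4; 0; 1; 34; 33]]);
    (28, [:: [:: 32; 27; 29; 31; 30; 26; 24; 20; 21; 19; 18; 35; 2; 0; 4; 5; 3; 13;
    12; 11; 17; 15; 22; 25; 23; 16; 14; 9; 10; 7; 6; 8; 1; 34; 33]]);
    (29, [:: [:: 35; 32; 27; 19; 18; 13; 12; 11; 7; 6; 4; 5; 3; 2; 0; 1; 8; 9; 10;
    15; 17; 20; 21; 28; 26; 24; 22; 25; 30; 31; 33; 23; 16; 14; 34]]);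
    (30, [:: [:: 32; 27; 19; 18; 35; 2; 3; 13; 12; 21; 20; 17; 11; 5; 4; 0; 1; 34;
    14; 9; 8; 6; 7; 10; 15; 16; 23; 25; 22; 24; 26; 28; 29; 31; 33]]);
    (31, [:: [:: 35; 32; 27; 29; 28; 26; 30; 25; 22; 24; 20; 17; 15; 10; 7; 6; 4;
    5; 11; 12; 21; 19; 18; 13; 3; 2; 0; 1; 8; 9; 14; 16; 23; 33; 34]]);
    (32, [:: [:: 35; 2; 3; 5; 11; 7; 6; 4; 0; 1; 8; 9; 10; 15; 17; 20; 24; 22; 25;
    30; 26; 28; 21; 12; 13; 18; 19; 27; 29; 31; 33; 23; 16; 14; 34]]);
    (33, [:: [:: 35; 32; 27; 19; 18; 13; 3; 2; 0; 1; 8; 9; 10; 7; 6; 4; 5; 11; 12;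
    21; 20; 17; 15; 22; 24; 26; 28; 29; 31; 30; 25; 23; 16; 14; 34]]);
    (34, [:: [:: 32; 27; 19; 18; 35; 2; 3; 13; 12; 21; 28; 29; 31; 30; 26; 24; 20;
    17; 11; 5; 4; 0; 1; 8; 6; 7; 10; 9; 14; 16; 15; 22; 25; 23; 33]]);
    (35, [:: [:: 32; 27; 19; 18; 13; 12; 21; 28; 29; 31; 30; 26; 24; 20; 17; 11; 7;
    10; 15; 22; 25; 23; 16; 14; 9; 8; 6; 4; 5; 3; 2; 0; 1; 34; 33]])]
|}.

Definition base39 : base := {|
  core := 35;
  hub := 34;
  radius := 100%Z;
  inner := [::
    (0, 2); (0, 1); (0, 4); (1, 3); (1, 37); (2, 7); (2, 36); (3, 6); (3, 10);
    (4, 5); (4, 6); (5, 7); (5, 11); (6, 8); (7, 16); (8, 11); (8, 9); (9, 13);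
    (9, 10); (10, 15); (11, 12); (12, 16); (12, 13); (13, 14); (14, 17); (14, 15);
    (15, 18); (15, 37); (16, 24); (16, 17); (17, 22); (18, 22); (18, 19); (19, 20);
    (19, 38); (20, 29); (20, 21); (21, 22); (21, 27); (22, 23); (23, 24); (23, 25);
    (24, 30); (24, 36); (25, 26); (25, 27); (26, 30); (26, 32); (27, 28); (28, 32);
    (28, 29); (29, 31); (30, 34); (31, 33); (31, 38); (32, 33); (33, 34); (34, 35)];
  place := [::
    (78, 9); (83, 49); (81, -34); (71, 37); (71, 12); (66, 4); (68, 23); (65, -12);
    (63, 21); (60, 28); (62, 39); (61, 11); (55, 9); (54, 22); (49, 30); (55, 54);
    (49, -5); (37, 15); (9, 45); (-41, 62); (-31, 41); (-12, 25); (12, 20);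
    (15, -4); (38, -34); (-5, 1); (-16, -7); (-15, 15); (-29, 18); (-41, 35);
    (-10, -28); (-64, 46); (-32, 5); (-49, 3); (-53, -42)]%Z;
  covers := [::
    (0, [:: [:: 35; 34; 33; 31; 38; 19; 18; 22; 23; 25; 27; 21; 20; 29; 28; 32; 26;
    30; 24; 16; 17; 14; 13; 12; 11; 8; 9; 10; 15; 37; 1; 3; 6; 4; 5; 7; 2; 36]]);
    (1, [:: [:: 38; 35; 34; 30; 26; 25; 23; 24; 36; 2; 0; 4; 6; 3; 10; 9; 8; 11; 5;
    7; 16; 12; 13; 14; 17; 22; 21; 27; 28; 32; 33; 31; 29; 20; 19; 18; 15; 37]]);
    (2, [:: [:: 35; 34; 33; 31; 38; 19; 18; 15; 37; 1; 0; 4; 5; 7; 16; 12; 11; 8;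
    6; 3; 10; 9; 13; 14; 17; 22; 23; 25; 27; 21; 20; 29; 28; 32; 26; 30; 24; 36]]);
    (3, [:: [:: 35; 34; 33; 31; 38; 19; 18; 22; 23; 25; 27; 21; 20; 29; 28; 32; 26;
    30; 24; 16; 17; 14; 15; 10; 9; 13; 12; 11; 8; 6; 4; 5; 7; 2; 0; 1; 37; 36]]);
    (4, [:: [:: 35; 34; 33; 31; 38; 19; 18; 22; 23; 25; 27; 21; 20; 29; 28; 32; 26;
    30; 24; 16; 17; 14; 13; 12; 11; 5; 7; 2; 0; 1; 3; 6; 8; 9; 10; 15; 37; 36]]);
    (5, [:: [:: 35; 34; 33; 31; 38; 19; 18; 15; 14; 17; 22; 23; 25; 27; 21; 20; 29;
    28; 32; 26; 30; 24; 16; 7; 2; 0; 4; 6; 8; 11; 12; 13; 9; 10; 3; 1; 37; 36]]);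
    (6, [:: [:: 35; 34; 33; 31; 38; 19; 18; 15; 37; 1; 3; 10; 9; 8; 11; 5; 4; 0; 2;
    7; 16; 12; 13; 14; 17; 22; 23; 25; 27; 21; 20; 29; 28; 32; 26; 30; 24; 36]]);
    (7, [:: [:: 38; 35; 34; 33; 31; 29; 28; 32; 26; 30; 24; 23; 25; 27; 21; 20; 19;
    18; 22; 17; 16; 12; 13; 14; 15; 10; 9; 8; 11; 5; 4; 6; 3; 1; 0; 2; 36; 37]]);
    (8, [:: [:: 35; 34; 33; 31; 38; 19; 18; 22; 23; 25; 27; 21; 20; 29; 28; 32; 26;
    30; 24; 16; 17; 14; 15; 10; 9; 13; 12; 11; 5; 7; 2; 0; 4; 6; 3; 1; 37; 36]]);
    (9, [:: [:: 35; 34; 33; 31; 38; 19; 18; 22; 23; 25; 27; 21; 20; 29; 28; 32; 26;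
    30; 24; 16; 17; 14; 13; 12; 11; 8; 6; 4; 5; 7; 2; 0; 1; 3; 10; 15; 37; 36]]);
    (10, [:: [:: 35; 34; 33; 31; 38; 19; 18; 15; 14; 17; 22; 23; 25; 27; 21; 20;
    29; 28; 32; 26; 30; 24; 16; 7; 2; 0; 4; 5; 11; 12; 13; 9; 8; 6; 3; 1; 37; 36]]);
    (11, [:: [:: 38; 35; 34; 30; 26; 25; 23; 24; 36; 2; 0; 4; 5; 7; 16; 12; 13; 14;
    17; 22; 21; 27; 28; 32; 33; 31; 29; 20; 19; 18; 15; 10; 9; 8; 6; 3; 1; 37]]);
    (12, [:: [:: 35; 34; 33; 31; 38; 19; 18; 15; 10; 3; 6; 4; 5; 11; 8; 9; 13; 14;
    17; 22; 23; 25; 27; 21; 20; 29; 28; 32; 26; 30; 24; 16; 7; 2; 0; 1; 37; 36]]);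
    (13, [:: [:: 35; 34; 33; 31; 38; 19; 18; 15; 14; 17; 22; 23; 25; 27; 21; 20;
    29; 28; 32; 26; 30; 24; 16; 12; 11; 5; 7; 2; 0; 4; 6; 8; 9; 10; 3; 1; 37; 36]]);
    (14, [:: [:: 38; 35; 34; 30; 26; 25; 23; 24; 36; 2; 7; 16; 17; 22; 21; 27; 28;
    32; 33; 31; 29; 20; 19; 18; 15; 10; 3; 6; 8; 9; 13; 12; 11; 5; 4; 0; 1; 37]]);
    (15, [:: [:: 35; 34; 33; 31; 38; 19; 18; 22; 23; 25; 27; 21; 20; 29; 28; 32;
    26; 30; 24; 16; 17; 14; 13; 12; 11; 5; 7; 2; 0; 4; 6; 8; 9; 10; 3; 1; 37; 36]]);
    (16, [:: [:: 35; 34; 33; 31; 38; 19; 18; 15; 37; 1; 0; 2; 7; 5; 4; 6; 3; 10; 9;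
    8; 11; 12; 13; 14; 17; 22; 23; 25; 27; 21; 20; 29; 28; 32; 26; 30; 24; 36]]);
    (17, [:: [:: 35; 34; 33; 31; 38; 19; 18; 22; 23; 25; 27; 21; 20; 29; 28; 32;
    26; 30; 24; 16; 7; 2; 0; 1; 3; 10; 9; 8; 6; 4; 5; 11; 12; 13; 14; 15; 37; 36]]);
    (18, [:: [:: 35; 34; 33; 31; 38; 19; 20; 29; 28; 32; 26; 30; 24; 23; 25; 27;
    21; 22; 17; 16; 7; 2; 0; 1; 3; 10; 9; 8; 6; 4; 5; 11; 12; 13; 14; 15; 37; 36]]);
    (19, [:: [:: 35; 38; 31; 33; 34; 30; 26; 32; 28; 29; 20; 21; 27; 25; 23; 24;
    16; 7; 2; 0; 1; 3; 10; 9; 8; 6; 4; 5; 11; 12; 13; 14; 17; 22; 18; 15; 37; 36]]);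
    (20, [:: [:: 36; 2; 7; 5; 11; 12; 16; 17; 14; 13; 9; 8; 6; 4; 0; 1; 3; 10; 15;
    37]; [:: 38; 19; 18; 22; 21; 27; 25; 23; 24; 30; 26; 32; 28; 29; 31; 33; 34;
    35]]);
    (21, [:: [:: 35; 34; 30; 26; 32; 33; 31; 38; 19; 20; 29; 28; 27; 25; 23; 24;
    16; 7; 2; 0; 1; 3; 10; 9; 8; 6; 4; 5; 11; 12; 13; 14; 17; 22; 18; 15; 37; 36]]);
    (22, [:: [:: 38; 35; 34; 33; 31; 29; 28; 32; 26; 30; 24; 23; 25; 27; 21; 20;
    19; 18; 15; 10; 3; 1; 0; 4; 6; 8; 9; 13; 14; 17; 16; 12; 11; 5; 7; 2; 36; 37]]);
    (23, [:: [:: 35; 34; 33; 32; 28; 29; 31; 38; 19; 20; 21; 27; 25; 26; 30; 24;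
    16; 7; 2; 0; 1; 3; 10; 9; 8; 6; 4; 5; 11; 12; 13; 14; 17; 22; 18; 15; 37; 36]]);
    (24, [:: [:: 38; 35; 34; 30; 26; 25; 23; 22; 21; 27; 28; 32; 33; 31; 29; 20;
    19; 18; 15; 10; 9; 8; 6; 3; 1; 0; 4; 5; 11; 12; 13; 14; 17; 16; 7; 2; 36; 37]]);
    (25, [:: [:: 38; 35; 34; 30; 26; 32; 33; 31; 29; 28; 27; 21; 20; 19; 18; 15;
    14; 13; 12; 11; 8; 9; 10; 3; 6; 4; 5; 7; 16; 17; 22; 23; 24; 36; 2; 0; 1; 37]]);
    (26, [:: [:: 35; 34; 30; 24; 23; 25; 27; 21; 20; 29; 28; 32; 33; 31; 38; 19;
    18; 22; 17; 16; 7; 2; 0; 1; 3; 10; 9; 8; 6; 4; 5; 11; 12; 13; 14; 15; 37; 36]]);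
    (27, [:: [:: 35; 34; 30; 26; 25; 23; 24; 16; 7; 2; 0; 1; 3; 10; 9; 8; 6; 4; 5;
    11; 12; 13; 14; 17; 22; 21; 20; 29; 28; 32; 33; 31; 38; 19; 18; 15; 37; 36]]);
    (28, [:: [:: 35; 34; 33; 32; 26; 30; 24; 23; 25; 27; 21; 20; 29; 31; 38; 19;
    18; 22; 17; 16; 7; 2; 0; 1; 3; 10; 9; 8; 6; 4; 5; 11; 12; 13; 14; 15; 37; 36]]);
    (29, [:: [:: 35; 38; 31; 33; 34; 30; 26; 32; 28; 27; 25; 23; 24; 16; 7; 2; 0;
    1; 3; 10; 9; 8; 6; 4; 5; 11; 12; 13; 14; 17; 22; 21; 20; 19; 18; 15; 37; 36]]);
    (30, [:: [:: 38; 35; 34; 33; 31; 29; 20; 19; 18; 15; 14; 13; 12; 11; 8; 9; 10;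
    3; 6; 4; 5; 7; 16; 17; 22; 21; 27; 28; 32; 26; 25; 23; 24; 36; 2; 0; 1; 37]]);
    (31, [:: [:: 36; 2; 7; 5; 11; 12; 16; 17; 14; 13; 9; 8; 6; 4; 0; 1; 3; 10; 15;
    37]; [:: 38; 19; 18; 22; 23; 24; 30; 26; 25; 27; 21; 20; 29; 28; 32; 33; 34;
    35]]);
    (32, [:: [:: 35; 38; 31; 33; 34; 30; 26; 25; 23; 24; 16; 7; 2; 0; 1; 3; 10; 9;
    8; 6; 4; 5; 11; 12; 13; 14; 17; 22; 21; 27; 28; 29; 20; 19; 18; 15; 37; 36]]);
    (33, [:: [:: 35; 34; 30; 26; 32; 28; 29; 31; 38; 19; 20; 21; 27; 25; 23; 24;
    16; 7; 2; 0; 1; 3; 10; 9; 8; 6; 4; 5; 11; 12; 13; 14; 17; 22; 18; 15; 37; 36]]);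
    (35, [:: [:: 38; 19; 18; 15; 14; 13; 12; 11; 8; 9; 10; 3; 6; 4; 5; 7; 16; 17;
    22; 23; 25; 26; 32; 28; 27; 21; 20; 29; 31; 33; 34; 30; 24; 36; 2; 0; 1; 37]]);
    (36, [:: [:: 38; 35; 34; 30; 26; 25; 23; 24; 16; 17; 22; 21; 27; 28; 32; 33;
    31; 29; 20; 19; 18; 15; 14; 13; 12; 11; 8; 9; 10; 3; 6; 4; 5; 7; 2; 0; 1; 37]]);
    (37, [:: [:: 35; 34; 33; 31; 38; 19; 18; 15; 14; 17; 22; 23; 25; 27; 21; 20;
    29; 28; 32; 26; 30; 24; 16; 7; 5; 4; 6; 8; 11; 12; 13; 9; 10; 3; 1; 0; 2; 36]]);
    (38, [:: [:: 35; 34; 33; 31; 29; 28; 32; 26; 30; 24; 23; 25; 27; 21; 20; 19;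
    18; 22; 17; 16; 7; 2; 0; 1; 3; 10; 9; 8; 6; 4; 5; 11; 12; 13; 14; 15; 37; 36]])]
|}.

Definition base42 : base := {|
  core := 38;
  hub := 34;
  radius := 100%Z;
  inner := [::
    (0, 1); (0, 4); (0, 7); (1, 2); (1, 5); (2, 9); (2, 3); (3, 11); (3, 4);
    (4, 10); (5, 6); (5, 8); (6, 9); (6, 40); (7, 8); (7, 16); (8, 14); (9, 12);
    (10, 13); (10, 16); (11, 12); (11, 13); (12, 15); (12, 39); (13, 17); (14, 18);
    (14, 40); (15, 20); (15, 17); (16, 19); (16, 18); (17, 19); (18, 22); (19, 21);
    (20, 29); (20, 21); (21, 24); (21, 22); (22, 23); (22, 41); (23, 35); (23, 26);
    (24, 25); (24, 26); (25, 29); (25, 28); (26, 27); (27, 28); (27, 31); (28, 30);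
    (29, 33); (29, 39); (30, 33); (30, 32); (31, 32); (31, 35); (32, 36); (33, 34);
    (34, 36); (34, 38); (35, 37); (36, 37); (37, 41)];
  place := [::
    (57, 30); (63, 32); (65, 21); (60, 14); (55, 21); (68, 45); (80, 54); (52, 36);
    (61, 49); (71, 17); (48, 19); (60, -1); (70, -24); (50, 8); (62, 65);
    (47, -10); (39, 30); (42, 4); (26, 48); (30, 16); (29, -12); (9, 14);
    (-23, 48); (-26, 29); (0, 4); (7, -15); (-15, 12); (-19, 5); (-11, -8);
    (30, -40); (-20, -15); (-31, 10); (-34, -2); (-15, -33); (-55, -45); (-40, 27);
    (-51, -2); (-64, 42)]%Z;
  covers := [::
    (0, [:: [:: 38; 34; 36; 37; 41; 22; 18; 14; 8; 7; 16; 19; 21; 24; 25; 28; 27;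
    26; 23; 35; 31; 32; 30; 33; 29; 20; 15; 17; 13; 10; 4; 3; 11; 12; 9; 2; 1; 5;
    6; 40; 39]]);
    (1, [:: [:: 38; 34; 36; 37; 41; 22; 18; 14; 40; 6; 5; 8; 7; 0; 4; 3; 2; 9; 12;
    11; 13; 10; 16; 19; 17; 15; 20; 21; 24; 25; 28; 27; 26; 23; 35; 31; 32; 30; 33;
    29; 39]]);
    (2, [:: [:: 38; 34; 36; 37; 41; 22; 18; 14; 8; 5; 1; 0; 7; 16; 19; 21; 24; 25;
    28; 27; 26; 23; 35; 31; 32; 30; 33; 29; 20; 15; 17; 13; 10; 4; 3; 11; 12; 9; 6;
    40; 39]]);
    (3, [:: [:: 38; 34; 36; 37; 41; 22; 18; 14; 8; 7; 0; 4; 10; 16; 19; 21; 24; 25;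
    28; 27; 26; 23; 35; 31; 32; 30; 33; 29; 20; 15; 17; 13; 11; 12; 9; 2; 1; 5; 6;
    40; 39]]);
    (4, [:: [:: 38; 34; 36; 37; 41; 22; 18; 14; 8; 5; 1; 0; 7; 16; 10; 13; 17; 19;
    21; 24; 25; 28; 27; 26; 23; 35; 31; 32; 30; 33; 29; 20; 15; 12; 11; 3; 2; 9; 6;
    40; 39]]);
    (5, [:: [:: 38; 34; 36; 37; 41; 22; 18; 14; 8; 7; 16; 19; 21; 24; 25; 28; 27;
    26; 23; 35; 31; 32; 30; 33; 29; 20; 15; 17; 13; 10; 4; 0; 1; 2; 3; 11; 12; 9;
    6; 40; 39]]);
    (6, [:: [:: 41; 38; 34; 33; 30; 28; 25; 29; 39; 12; 9; 2; 1; 5; 8; 7; 0; 4; 3;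
    11; 13; 10; 16; 19; 17; 15; 20; 21; 24; 26; 27; 31; 32; 36; 37; 35; 23; 22; 18;
    14; 40]]);
    (7, [:: [:: 38; 34; 36; 37; 41; 22; 18; 16; 19; 21; 24; 25; 28; 27; 26; 23; 35;
    31; 32; 30; 33; 29; 20; 15; 17; 13; 10; 4; 0; 1; 2; 3; 11; 12; 9; 6; 5; 8; 14;
    40; 39]]);
    (8, [:: [:: 41; 38; 34; 33; 30; 28; 25; 29; 39; 12; 11; 13; 10; 4; 3; 2; 9; 6;
    5; 1; 0; 7; 16; 19; 17; 15; 20; 21; 24; 26; 27; 31; 32; 36; 37; 35; 23; 22; 18;
    14; 40]]);
    (9, [:: [:: 38; 34; 36; 37; 41; 22; 18; 14; 40; 6; 5; 8; 7; 16; 19; 21; 24; 25;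
    28; 27; 26; 23; 35; 31; 32; 30; 33; 29; 20; 15; 17; 13; 10; 4; 0; 1; 2; 3; 11;
    12; 39]]);
    (10, [:: [:: 38; 34; 36; 37; 41; 22; 18; 14; 8; 5; 1; 2; 3; 4; 0; 7; 16; 19;
    21; 24; 25; 28; 27; 26; 23; 35; 31; 32; 30; 33; 29; 20; 15; 17; 13; 11; 12; 9;
    6; 40; 39]]);
    (11, [:: [:: 38; 34; 36; 37; 41; 22; 18; 14; 8; 5; 1; 2; 3; 4; 0; 7; 16; 10;
    13; 17; 19; 21; 24; 25; 28; 27; 26; 23; 35; 31; 32; 30; 33; 29; 20; 15; 12; 9;
    6; 40; 39]]);
    (12, [:: [:: 38; 34; 36; 37; 41; 22; 18; 14; 40; 6; 9; 2; 3; 11; 13; 10; 4; 0;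
    1; 5; 8; 7; 16; 19; 17; 15; 20; 21; 24; 25; 28; 27; 26; 23; 35; 31; 32; 30; 33;
    29; 39]]);
    (13, [:: [:: 38; 34; 36; 37; 41; 22; 18; 14; 40; 6; 9; 12; 11; 3; 2; 1; 5; 8;
    7; 0; 4; 10; 16; 19; 17; 15; 20; 21; 24; 25; 28; 27; 26; 23; 35; 31; 32; 30;
    33; 29; 39]]);
    (14, [:: [:: 38; 34; 36; 37; 41; 22; 18; 16; 19; 21; 24; 25; 28; 27; 26; 23;
    35; 31; 32; 30; 33; 29; 20; 15; 17; 13; 10; 4; 3; 11; 12; 9; 2; 1; 0; 7; 8; 5;
    6; 40; 39]]);
    (15, [:: [:: 41; 38; 34; 36; 37; 35; 23; 26; 24; 25; 28; 27; 31; 32; 30; 33;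
    29; 20; 21; 22; 18; 14; 8; 7; 0; 4; 10; 16; 19; 17; 13; 11; 3; 2; 1; 5; 6; 9;
    12; 39; 40]]);
    (16, [:: [:: 41; 38; 34; 33; 30; 28; 25; 24; 26; 27; 31; 32; 36; 37; 35; 23;
    22; 18; 14; 8; 7; 0; 4; 10; 13; 11; 3; 2; 1; 5; 6; 9; 12; 15; 17; 19; 21; 20;
    29; 39; 40]]);
    (17, [:: [:: 38; 34; 36; 37; 41; 22; 18; 14; 8; 5; 1; 2; 3; 11; 13; 10; 4; 0;
    7; 16; 19; 21; 24; 25; 28; 27; 26; 23; 35; 31; 32; 30; 33; 29; 20; 15; 12; 9;
    6; 40; 39]]);
    (18, [:: [:: 38; 34; 36; 37; 41; 22; 23; 35; 31; 32; 30; 33; 29; 25; 28; 27;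
    26; 24; 21; 20; 15; 17; 19; 16; 10; 13; 11; 12; 9; 6; 5; 1; 2; 3; 4; 0; 7; 8;
    14; 40; 39]]);
    (19, [:: [:: 38; 34; 36; 37; 41; 22; 21; 24; 25; 28; 27; 26; 23; 35; 31; 32;
    30; 33; 29; 20; 15; 17; 13; 11; 12; 9; 6; 5; 8; 7; 0; 1; 2; 3; 4; 10; 16; 18;
    14; 40; 39]]);
    (20, [:: [:: 38; 34; 36; 37; 41; 22; 18; 14; 40; 6; 9; 2; 3; 11; 12; 15; 17;
    13; 10; 4; 0; 1; 5; 8; 7; 16; 19; 21; 24; 25; 28; 27; 26; 23; 35; 31; 32; 30;
    33; 29; 39]]);
    (21, [:: [:: 41; 38; 34; 33; 30; 28; 25; 24; 26; 27; 31; 32; 36; 37; 35; 23;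
    22; 18; 14; 8; 5; 1; 0; 7; 16; 19; 17; 15; 20; 29; 39; 12; 11; 13; 10; 4; 3; 2;
    9; 6; 40]]);
    (22, [:: [:: 38; 41; 37; 36; 34; 33; 30; 32; 31; 35; 23; 26; 27; 28; 25; 24;
    21; 19; 17; 13; 11; 3; 2; 1; 5; 8; 7; 0; 4; 10; 16; 18; 14; 40; 6; 9; 12; 15;
    20; 29; 39]]);
    (23, [:: [:: 39; 40]; [:: 41; 22; 18; 14; 8; 5; 6; 9; 12; 11; 13; 10; 4; 3; 2;
    1; 0; 7; 16; 19; 17; 15; 20; 21; 24; 26; 27; 28; 25; 29; 33; 30; 32; 31; 35;
    37; 36; 34; 38]]);
    (24, [:: [:: 41; 38; 34; 36; 37; 35; 31; 32; 30; 33; 29; 25; 28; 27; 26; 23;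
    22; 18; 14; 8; 7; 16; 10; 4; 0; 1; 5; 6; 9; 2; 3; 11; 13; 17; 19; 21; 20; 15;
    12; 39; 40]]);
    (25, [:: [:: 38; 34; 36; 32; 31; 27; 28; 30; 33; 29; 20; 15; 17; 19; 21; 24;
    26; 23; 35; 37; 41; 22; 18; 14; 8; 5; 1; 2; 3; 4; 0; 7; 16; 10; 13; 11; 12; 9;
    6; 40; 39]]);
    (26, [:: [:: 38; 34; 33; 30; 32; 36; 37; 41; 22; 23; 35; 31; 27; 28; 25; 24;
    21; 19; 17; 13; 11; 3; 2; 1; 5; 8; 7; 0; 4; 10; 16; 18; 14; 40; 6; 9; 12; 15;
    20; 29; 39]]);
    (27, [:: [:: 38; 34; 33; 30; 28; 25; 29; 20; 15; 17; 19; 21; 24; 26; 23; 35;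
    31; 32; 36; 37; 41; 22; 18; 14; 8; 5; 1; 2; 3; 4; 0; 7; 16; 10; 13; 11; 12; 9;
    6; 40; 39]]);
    (28, [:: [:: 41; 38; 34; 33; 30; 32; 36; 37; 35; 31; 27; 26; 23; 22; 18; 14; 8;
    5; 1; 0; 7; 16; 19; 17; 15; 20; 21; 24; 25; 29; 39; 12; 11; 13; 10; 4; 3; 2; 9;
    6; 40]]);
    (29, [:: [:: 41; 38; 34; 33; 30; 28; 25; 24; 26; 27; 31; 32; 36; 37; 35; 23;
    22; 18; 14; 8; 7; 16; 10; 4; 0; 1; 5; 6; 9; 2; 3; 11; 13; 17; 19; 21; 20; 15;
    12; 39; 40]]);
    (30, [:: [:: 38; 34; 33; 29; 20; 15; 17; 19; 21; 24; 25; 28; 27; 26; 23; 35;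
    31; 32; 36; 37; 41; 22; 18; 14; 8; 5; 1; 2; 3; 4; 0; 7; 16; 10; 13; 11; 12; 9;
    6; 40; 39]]);
    (31, [:: [:: 38; 34; 36; 32; 30; 33; 29; 20; 15; 17; 19; 21; 24; 25; 28; 27;
    26; 23; 35; 37; 41; 22; 18; 14; 8; 5; 1; 2; 3; 4; 0; 7; 16; 10; 13; 11; 12; 9;
    6; 40; 39]]);
    (32, [:: [:: 38; 41; 37; 36; 34; 33; 30; 28; 25; 29; 20; 15; 17; 19; 21; 24;
    26; 27; 31; 35; 23; 22; 18; 14; 8; 5; 1; 2; 3; 4; 0; 7; 16; 10; 13; 11; 12; 9;
    6; 40; 39]]);
    (33, [:: [:: 41; 38; 34; 36; 37; 35; 23; 22; 18; 14; 8; 5; 1; 0; 7; 16; 19; 17;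
    15; 20; 21; 24; 26; 27; 31; 32; 30; 28; 25; 29; 39; 12; 11; 13; 10; 4; 3; 2; 9;
    6; 40]]);
    (35, [:: [:: 38; 34; 33; 30; 28; 25; 24; 21; 20; 29; 39]; [:: 40; 6; 9; 12; 15;
    17; 19; 16; 7; 0; 4; 10; 13; 11; 3; 2; 1; 5; 8; 14; 18; 22; 23; 26; 27; 31; 32;
    36; 37; 41]]);
    (36, [:: [:: 38; 34; 33; 30; 32; 31; 35; 37; 41; 22; 23; 26; 27; 28; 25; 24;
    21; 19; 17; 13; 11; 3; 2; 1; 5; 8; 7; 0; 4; 10; 16; 18; 14; 40; 6; 9; 12; 15;
    20; 29; 39]]);
    (37, [:: [:: 39; 40]; [:: 41; 22; 18; 14; 8; 5; 6; 9; 12; 11; 13; 10; 4; 3; 2;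
    1; 0; 7; 16; 19; 17; 15; 20; 21; 24; 25; 29; 33; 30; 28; 27; 26; 23; 35; 31;
    32; 36; 34; 38]]);
    (38, [:: [:: 41; 22; 18; 14; 8; 5; 1; 0; 7; 16; 19; 17; 15; 20; 21; 24; 25; 28;
    30; 32; 31; 27; 26; 23; 35; 37; 36; 34; 33; 29; 39; 12; 11; 13; 10; 4; 3; 2; 9;
    6; 40]]);
    (39, [:: [:: 41; 38; 34; 36; 37; 35; 23; 26; 24; 25; 28; 27; 31; 32; 30; 33;
    29; 20; 21; 22; 18; 14; 8; 5; 1; 2; 3; 11; 13; 10; 4; 0; 7; 16; 19; 17; 15; 12;
    9; 6; 40]]);
    (40, [:: [:: 38; 34; 36; 37; 41; 22; 18; 14; 8; 5; 6; 9; 2; 1; 0; 7; 16; 19;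
    21; 24; 25; 28; 27; 26; 23; 35; 31; 32; 30; 33; 29; 20; 15; 17; 13; 10; 4; 3;
    11; 12; 39]]);
    (41, [:: [:: 38; 34; 36; 37; 35; 23; 26; 24; 25; 28; 27; 31; 32; 30; 33; 29;
    20; 15; 17; 19; 21; 22; 18; 14; 8; 5; 1; 2; 3; 4; 0; 7; 16; 10; 13; 11; 12; 9;
    6; 40; 39]])]
|}.

Definition base45 : base := {|
  core := 41;
  hub := 14;
  radius := 100%Z;
  inner := [::
    (0, 5); (0, 4); (0, 1); (1, 2); (1, 11); (2, 3); (2, 10); (3, 4); (3, 8);
    (4, 7); (5, 15); (5, 6); (6, 12); (6, 11); (7, 15); (7, 9); (8, 9); (8, 18);
    (9, 17); (10, 18); (10, 23); (11, 23); (11, 19); (12, 14); (12, 13); (13, 19);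
    (13, 44); (14, 15); (14, 41); (15, 16); (16, 17); (16, 42); (17, 20); (18, 20);
    (18, 22); (19, 24); (20, 21); (21, 31); (21, 42); (22, 31); (22, 25); (23, 25);
    (23, 27); (24, 27); (24, 26); (25, 28); (26, 38); (26, 44); (27, 29); (27, 32);
    (28, 30); (28, 29); (29, 33); (30, 31); (30, 35); (31, 37); (32, 34); (32, 38);
    (33, 35); (33, 34); (34, 39); (35, 36); (36, 37); (36, 39); (37, 43); (38, 40);
    (39, 40); (40, 43)];
  place := [::
    (4, -12); (3, -2); (13, -5); (16, -13); (11, -18); (-3, -17); (-16, -2);
    (13, -28); (25, -17); (26, -28); (19, 1); (-7, 12); (-39, -1); (-55, 44);
    (-45, -46); (3, -38); (48, -59); (40, -39); (32, -10); (-27, 35); (46, -29);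
    (67, -39); (38, 6); (12, 16); (-18, 48); (27, 16); (-35, 71); (9, 38);
    (31, 25); (25, 35); (43, 25); (54, 11); (18, 51); (33, 41); (32, 50); (43, 39);
    (52, 51); (69, 54); (12, 66); (46, 59); (52, 75)]%Z;
  covers := [::
    (0, [:: [:: 41; 14; 12; 6; 5; 15; 16; 17; 9; 7; 4; 3; 8; 18; 20; 21; 31; 22;
    25; 23; 10; 2; 1; 11; 19; 13; 44; 26; 24; 27; 29; 28; 30; 35; 33; 34; 32; 38;
    40; 39; 36; 37; 43; 42]]);
    (1, [:: [:: 41; 14; 12; 13; 44; 26; 24; 19; 11; 6; 5; 0; 4; 7; 15; 16; 17; 9;
    8; 3; 2; 10; 18; 20; 21; 31; 22; 25; 23; 27; 29; 28; 30; 35; 33; 34; 32; 38;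
    40; 39; 36; 37; 43; 42]]);
    (2, [:: [:: 41; 14; 12; 6; 5; 15; 7; 9; 8; 3; 4; 0; 1; 11; 23; 10; 18; 22; 25;
    28; 30; 31; 21; 20; 17; 16; 42]; [:: 43; 37; 36; 35; 33; 29; 27; 32; 34; 39;
    40; 38; 26; 24; 19; 13; 44]]);
    (3, [:: [:: 41; 14; 12; 6; 5; 0; 4; 7; 15; 16; 17; 9; 8; 18; 20; 21; 31; 22;
    25; 23; 10; 2; 1; 11; 19; 13; 44; 26; 24; 27; 29; 28; 30; 35; 33; 34; 32; 38;
    40; 39; 36; 37; 43; 42]]);
    (4, [:: [:: 42; 16; 17; 20; 21; 31; 37; 43]; [:: 44; 13; 12; 6; 5; 0; 1; 11;
    19; 24; 26; 38; 40; 39; 36; 35; 30; 28; 29; 33; 34; 32; 27; 23; 25; 22; 18; 10;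
    2; 3; 8; 9; 7; 15; 14; 41]]);
    (5, [:: [:: 42; 16; 17; 9; 8; 3; 2; 10; 18; 20; 21; 31; 22; 25; 23; 27; 29; 28;
    30; 35; 33; 34; 32; 38; 40; 39; 36; 37; 43]; [:: 44; 26; 24; 19; 13; 12; 6; 11;
    1; 0; 4; 7; 15; 14; 41]]);
    (6, [:: [:: 42; 16; 17; 20; 21; 31; 37; 36; 35; 30; 28; 25; 22; 18; 8; 9; 7; 4;
    3; 2; 10; 23; 11; 1; 0; 5; 15; 14; 12; 13; 19; 24; 26; 38; 32; 27; 29; 33; 34;
    39; 40; 43]; [:: 44; 41]]);
    (7, [:: [:: 41; 14; 12; 13; 44; 26; 24; 19; 11; 6; 5; 15; 16; 17; 9; 8; 3; 4;
    0; 1; 2; 10; 18; 20; 21; 31; 22; 25; 23; 27; 29; 28; 30; 35; 33; 34; 32; 38;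
    40; 39; 36; 37; 43; 42]]);
    (8, [:: [:: 44; 41; 14; 15; 16; 42; 21; 31; 30; 28; 25; 22; 18; 20; 17; 9; 7;
    4; 3; 2; 10; 23; 11; 1; 0; 5; 6; 12; 13; 19; 24; 26; 38; 40; 39; 34; 32; 27;
    29; 33; 35; 36; 37; 43]]);
    (9, [:: [:: 41; 14; 12; 13; 44; 26; 24; 19; 11; 6; 5; 0; 1; 2; 10; 23; 25; 22;
    18; 8; 3; 4; 7; 15; 16; 17; 20; 21; 31; 37; 36; 39; 34; 33; 35; 30; 28; 29; 27;
    32; 38; 40; 43; 42]]);
    (10, [:: [:: 41; 14; 12; 13; 44; 26; 24; 19; 11; 6; 5; 15; 16; 17; 9; 7; 4; 0;
    1; 2; 3; 8; 18; 20; 21; 31; 22; 25; 23; 27; 29; 28; 30; 35; 33; 34; 32; 38; 40;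
    39; 36; 37; 43; 42]]);
    (11, [:: [:: 41; 14; 12; 6; 5; 15; 7; 9; 8; 3; 4; 0; 1; 2; 10; 18; 22; 25; 23;
    27; 24; 19; 13; 44; 26; 38; 32; 34; 33; 29; 28; 30; 35; 36; 39; 40; 43; 37; 31;
    21; 20; 17; 16; 42]]);
    (12, [:: [:: 41; 14; 15; 16; 17; 9; 7; 4; 3; 8; 18; 20; 21; 31; 22; 25; 23; 10;
    2; 1; 0; 5; 6; 11; 19; 13; 44; 26; 24; 27; 29; 28; 30; 35; 33; 34; 32; 38; 40;
    39; 36; 37; 43; 42]]);
    (13, [:: [:: 42; 16; 17; 9; 8; 3; 4; 7; 15; 5; 0; 1; 2; 10; 18; 20; 21; 31; 22;
    25; 23; 27; 29; 28; 30; 35; 33; 34; 32; 38; 40; 39; 36; 37; 43]; [:: 44; 26;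
    24; 19; 11; 6; 12; 14; 41]]);
    (15, [:: [:: 41; 14; 12; 13; 19; 11; 6; 5; 0; 1; 2; 3; 4; 7; 9; 8; 18; 10; 23;
    25; 22; 31; 21; 20; 17; 16; 42]; [:: 43; 37; 36; 35; 30; 28; 29; 33; 34; 39;
    40; 38; 32; 27; 24; 26; 44]]);
    (16, [:: [:: 44; 41; 14; 12; 13; 19; 24; 26; 38; 40; 39; 34; 32; 27; 29; 33;
    35; 36; 37; 31; 30; 28; 25; 22; 18; 8; 3; 4; 0; 1; 2; 10; 23; 11; 6; 5; 15; 7;
    9; 17; 20; 21; 42; 43]]);
    (17, [:: [:: 42; 16; 15; 5; 6; 11; 1; 0; 4; 7; 9; 8; 3; 2; 10; 18; 20; 21; 31;
    22; 25; 23; 27; 29; 28; 30; 35; 33; 34; 32; 38; 40; 39; 36; 37; 43]; [:: 44;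
    26; 24; 19; 13; 12; 14; 41]]);
    (18, [:: [:: 41; 14; 12; 6; 5; 15; 16; 17; 20; 21; 31; 22; 25; 23; 10; 2; 3; 8;
    9; 7; 4; 0; 1; 11; 19; 13; 44; 26; 24; 27; 29; 28; 30; 35; 33; 34; 32; 38; 40;
    39; 36; 37; 43; 42]]);
    (19, [:: [:: 41; 14; 15; 16; 17; 20; 21; 42]; [:: 43; 37; 31; 30; 35; 36; 39;
    40; 38; 26; 24; 27; 32; 34; 33; 29; 28; 25; 22; 18; 8; 9; 7; 4; 3; 2; 10; 23;
    11; 1; 0; 5; 6; 12; 13; 44]]);
    (20, [:: [:: 41; 14; 12; 13; 19; 11; 6; 5; 15; 16; 17; 9; 7; 4; 0; 1; 2; 3; 8;
    18; 10; 23; 25; 22; 31; 21; 42]; [:: 43; 37; 36; 35; 30; 28; 29; 33; 34; 39;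
    40; 38; 32; 27; 24; 26; 44]]);
    (21, [:: [:: 41; 14; 12; 13; 44; 26; 24; 19; 11; 6; 5; 15; 7; 9; 8; 3; 4; 0; 1;
    2; 10; 23; 25; 28; 30; 35; 36; 39; 34; 33; 29; 27; 32; 38; 40; 43; 37; 31; 22;
    18; 20; 17; 16; 42]]);
    (22, [:: [:: 41; 14; 12; 6; 5; 15; 16; 17; 9; 7; 4; 0; 1; 11; 19; 13; 44; 26;
    24; 27; 29; 28; 25; 23; 10; 2; 3; 8; 18; 20; 21; 31; 30; 35; 33; 34; 32; 38;
    40; 39; 36; 37; 43; 42]]);
    (23, [:: [:: 41; 14; 12; 13; 44; 26; 24; 19; 11; 6; 5; 15; 7; 9; 8; 3; 4; 0; 1;
    2; 10; 18; 22; 25; 28; 30; 35; 36; 39; 34; 33; 29; 27; 32; 38; 40; 43; 37; 31;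
    21; 20; 17; 16; 42]]);
    (24, [:: [:: 42; 16; 17; 20; 21; 31; 37; 43]; [:: 44; 26; 38; 40; 39; 36; 35;
    30; 28; 29; 33; 34; 32; 27; 23; 25; 22; 18; 10; 2; 3; 8; 9; 7; 4; 0; 1; 11; 19;
    13; 12; 6; 5; 15; 14; 41]]);
    (25, [:: [:: 42; 16; 17; 20; 21; 31; 22; 18; 8; 9; 7; 15; 5; 6; 11; 1; 0; 4; 3;
    2; 10; 23; 27; 29; 28; 30; 35; 33; 34; 32; 38; 40; 39; 36; 37; 43]; [:: 44; 26;
    24; 19; 13; 12; 14; 41]]);
    (26, [:: [:: 41; 44; 13; 12; 14; 15; 16; 17; 9; 7; 4; 3; 8; 18; 20; 21; 31; 22;
    25; 23; 10; 2; 1; 0; 5; 6; 11; 19; 24; 27; 29; 28; 30; 35; 33; 34; 32; 38; 40;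
    39; 36; 37; 43; 42]]);
    (27, [:: [:: 41; 14; 15; 16; 17; 20; 21; 42]; [:: 43; 37; 31; 30; 35; 36; 39;
    40; 38; 32; 34; 33; 29; 28; 25; 22; 18; 8; 9; 7; 4; 3; 2; 10; 23; 11; 1; 0; 5;
    6; 12; 13; 19; 24; 26; 44]]);
    (28, [:: [:: 42; 21; 20; 17; 16; 15; 5; 6; 11; 1; 0; 4; 7; 9; 8; 3; 2; 10; 18;
    22; 25; 23; 27; 29; 33; 35; 30; 31; 37; 36; 39; 34; 32; 38; 40; 43]; [:: 44;
    26; 24; 19; 13; 12; 14; 41]]);
    (29, [:: [:: 41; 14; 12; 6; 5; 15; 16; 17; 9; 7; 4; 0; 1; 11; 19; 13; 44; 26;
    24; 27; 23; 10; 2; 3; 8; 18; 20; 21; 31; 22; 25; 28; 30; 35; 33; 34; 32; 38;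
    40; 39; 36; 37; 43; 42]]);
    (30, [:: [:: 41; 14; 12; 13; 44; 26; 38; 32; 34; 39; 40; 43; 37; 36; 35; 33;
    29; 28; 25; 22; 31; 21; 20; 17; 9; 7; 4; 0; 1; 2; 3; 8; 18; 10; 23; 27; 24; 19;
    11; 6; 5; 15; 16; 42]]);
    (31, [:: [:: 42; 21; 20; 17; 16; 15; 5; 6; 11; 1; 0; 4; 7; 9; 8; 3; 2; 10; 18;
    22; 25; 23; 27; 29; 28; 30; 35; 33; 34; 32; 38; 40; 39; 36; 37; 43]; [:: 44;
    26; 24; 19; 13; 12; 14; 41]]);
    (32, [:: [:: 44; 41; 14; 15; 5; 6; 12; 13; 19; 11; 1; 0; 4; 7; 9; 8; 3; 2; 10;
    23; 27; 24; 26; 38; 40; 39; 34; 33; 29; 28; 25; 22; 18; 20; 17; 16; 42; 21; 31;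
    30; 35; 36; 37; 43]]);
    (33, [:: [:: 41; 14; 12; 13; 44; 26; 24; 19; 11; 6; 5; 15; 7; 9; 8; 3; 4; 0; 1;
    2; 10; 18; 22; 25; 23; 27; 29; 28; 30; 35; 36; 39; 34; 32; 38; 40; 43; 37; 31;
    21; 20; 17; 16; 42]]);
    (34, [:: [:: 42; 16; 17; 9; 7; 15; 5; 6; 11; 23; 10; 2; 1; 0; 4; 3; 8; 18; 20;
    21; 31; 22; 25; 28; 30; 35; 33; 29; 27; 32; 38; 40; 39; 36; 37; 43]; [:: 44;
    26; 24; 19; 13; 12; 14; 41]]);
    (35, [:: [:: 41; 14; 12; 13; 44; 26; 24; 19; 11; 6; 5; 15; 7; 9; 8; 3; 4; 0; 1;
    2; 10; 18; 22; 25; 23; 27; 32; 38; 40; 43; 37; 36; 39; 34; 33; 29; 28; 30; 31;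
    21; 20; 17; 16; 42]]);
    (36, [:: [:: 41; 14; 12; 6; 5; 15; 16; 17; 9; 7; 4; 0; 1; 11; 23; 10; 2; 3; 8;
    18; 20; 21; 42]; [:: 43; 37; 31; 22; 25; 28; 30; 35; 33; 29; 27; 32; 34; 39;
    40; 38; 26; 24; 19; 13; 44]]);
    (37, [:: [:: 44; 41; 14; 15; 5; 6; 12; 13; 19; 11; 1; 0; 4; 7; 9; 8; 3; 2; 10;
    23; 25; 22; 18; 20; 17; 16; 42; 21; 31; 30; 28; 29; 33; 35; 36; 39; 34; 32; 27;
    24; 26; 38; 40; 43]]);
    (38, [:: [:: 41; 14; 12; 13; 44; 26; 24; 19; 11; 6; 5; 15; 7; 9; 8; 3; 4; 0; 1;
    2; 10; 18; 22; 25; 23; 27; 32; 34; 33; 29; 28; 30; 35; 36; 39; 40; 43; 37; 31;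
    21; 20; 17; 16; 42]]);
    (39, [:: [:: 42; 16; 17; 9; 8; 3; 4; 7; 15; 14; 12; 13; 19; 11; 6; 5; 0; 1; 2;
    10; 23; 25; 22; 18; 20; 21; 31; 37; 36; 35; 30; 28; 29; 33; 34; 32; 27; 24; 26;
    38; 40; 43]; [:: 44; 41]]);
    (40, [:: [:: 41; 14; 12; 6; 5; 15; 16; 17; 9; 7; 4; 0; 1; 11; 23; 10; 2; 3; 8;
    18; 20; 21; 31; 22; 25; 28; 30; 35; 33; 29; 27; 24; 19; 13; 44; 26; 38; 32; 34;
    39; 36; 37; 43; 42]]);
    (41, [:: [:: 44; 26; 24; 19; 13; 12; 14; 15; 5; 6; 11; 1; 0; 4; 7; 9; 8; 3; 2;
    10; 23; 27; 32; 38; 40; 39; 34; 33; 29; 28; 25; 22; 18; 20; 17; 16; 42; 21; 31;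
    30; 35; 36; 37; 43]]);
    (42, [:: [:: 44; 41; 14; 12; 13; 19; 24; 26; 38; 40; 39; 34; 32; 27; 23; 25;
    22; 18; 10; 2; 3; 8; 9; 7; 4; 0; 1; 11; 6; 5; 15; 16; 17; 20; 21; 31; 30; 28;
    29; 33; 35; 36; 37; 43]]);
    (43, [:: [:: 41; 14; 12; 13; 44; 26; 24; 19; 11; 6; 5; 15; 7; 9; 8; 3; 4; 0; 1;
    2; 10; 18; 22; 25; 23; 27; 29; 28; 30; 35; 33; 34; 32; 38; 40; 39; 36; 37; 31;
    21; 20; 17; 16; 42]]);
    (44, [:: [:: 41; 14; 12; 13; 19; 24; 26; 38; 32; 27; 29; 33; 34; 39; 40; 43;
    37; 36; 35; 30; 28; 25; 22; 31; 21; 20; 17; 9; 7; 4; 0; 1; 2; 3; 8; 18; 10; 23;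
    11; 6; 5; 15; 16; 42]])]
|}.

(** All checks are decided by evaluation; leaving the conversion to [Qed] makes the virtual machine
    run it only once. *)
Lemma base36_ok : base_ok base36.
Proof. vm_cast_no_check (erefl true). Qed.

Lemma base39_ok : base_ok base39.
Proof. vm_cast_no_check (erefl true). Qed.

Lemma base42_ok : base_ok base42.
Proof. vm_cast_no_check (erefl true). Qed.

Lemma base45_ok : base_ok base45.
Proof. vm_cast_no_check (erefl true). Qed.

Theorem theorem3p15 :
  forall n : nat, ((exists k : nat, n = 36 + 4 * k) \/ 73 <= n) ->
    exists (e : rel 'I_n) (w : 'I_n),
      [/\ simple_graph e, connected_graph e, planar e,
          almost_hypohamiltonian_with e w & degree e w = 3].
Proof.
move=> n [[k ->]|n73]; first exact: base_family base36_ok _.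
(* The orders 36, 45, 42, 39 represent the residues 0, 1, 2, 3 modulo 4 and have quotients 9, 11,
   10, 9. Since [n] is at least 73, the truncated subtractions are exact. *)
have En := divn_eq n 4; have := ltn_mod n 4.
case: (n %% 4) En => [|[|[|[|]]]] // En _.
- by apply: (@base_family _ (n %/ 4 - 9) _ base36_ok) => /=; lia.
- by apply: (@base_family _ (n %/ 4 - 11) _ base45_ok) => /=; lia.
- by apply: (@base_family _ (n %/ 4 - 10) _ base42_ok) => /=; lia.
- by apply: (@base_family _ (n %/ 4 - 9) _ base39_ok) => /=; lia.
Qed.
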